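(* Consider a sequence of inhomogeneous Cannings models indexed by $n\in\mathbb N_+$ satisfying (H1) and (H2a) (stated in the context), and let $h_*(n),h^*(n)$ be integer sequences such that $0<h_*(n)<h^*(n)<h(q_n)$ for all $n\ge1$ and $h_*(n)/n\to H_*$, $h^*(n)/n\to H^*$ as $n\to\infty$ for some constants $0<H_*<H^*<h(\ell)$. Let $X_{h_*(n)}$ be the number of vertices at height $h_*(n)$ of the Cannings tree $\mathscr T^n$ that have at least one descendant at height $h^*(n)$. Then the sequence $(X_{h_*(n)})$ is tight, i.e. $$\lim_{M\to\infty}\limsup_{n\to\infty}\mathbb P_n\big(X_{h_*(n)}>M\big)=0.$$
   Context: **Cannings models.** $\mathbb N=\{0,1,\dots\}$, $\mathbb N_+=\{1,2,\dots\}$. A discrete profile is a sequence $q=(q(s))_{s\in\mathbb N_+}$ in $\mathbb N$ with $q(s)=0$ for all $s\ge h(q):=\inf\{i\in\mathbb N_+:q(i)=0\}$. For each $n\in\mathbb N_+$ an inhomogeneous Cannings model is given by a discrete profile $q_n$ and random offspring vectors $\nu^{n,s}=(\nu^{n,s}_1,\dots,\nu^{n,s}_{q_n(s)})$, $s\in\mathbb N_+$, with entries in $\mathbb N$, such that: $\sum_i\nu^{n,s}_i=q_n(s+1)$; the law of $\nu^{n,s}$ is invariant under permutations of coordinates; the vectors $\nu^{n,s}$ are independent across $s$. Put $\sigma_n(s)\ge0$, $\sigma_n(s)^2:=\mathbf 1\{s<h(q_n)\}\mathrm{Var}(\nu^{n,s}_1)$. $(m)_k:=m(m-1)\cdots(m-k+1)$.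 $\mathbb P_n$ is the probability under the $n$-th model. **Cannings tree.** $\mathscr T^n$ is the random rooted ordered tree whose root (height $0$) has $q_n(1)$ children, and in which, for $s\ge1$, the $q_n(s)$ vertices at height $s$, listed in lexicographic (left-to-right) order, have $\nu^{n,s}_1,\dots,\nu^{n,s}_{q_n(s)}$ children respectively. **Continuous profiles.** $\ell:\mathbb R_+\to\mathbb R_+$ is a continuous profile if, with $h(\ell):=\inf\{y>0:\ell(y)=0\}$, $\ell(x)=0$ for all $x\ge h(\ell)$, and $\ell$ is continuous on $[0,h(\ell))$ with a finite left limit at $h(\ell)$ if $h(\ell)<\infty$. **(H1)** There exist continuous profiles $\ell,\sigma$ with $h(\ell)=h(\sigma)<\infty$ such that: (i) as $n\to\infty$, $h(q_n)/n\to h(\ell)$, $q_n(\lfloor n\,\cdot\rfloor)/n\to\ell$ uniformly on compact subsets of $(0,h(\ell))$, and $\sigma_n(\lfloor n\,\cdot\rfloor)\to\sigma$ uniformly on compact subsets of $(0,h(\sigma))$; (ii) $\lim_{\delta\to0}\sup_{n\in\mathbb N_+}\frac1{n^2}\sum_{s\in\mathbb N_+\setminus[\delta n,h(q_n)-\delta n]}q_n(s)=0$; (iii) the limits $\lim_{s\to0+}\ell(s)/\sigma(s)^2$ and $\lim_{s\to h(\ell)-}\ell(s)/\sigma(s)^2$ exist. **(H2a)** For every $\delta>0$ there exists $\varepsilon>0$ such that (infimum over integers $s$) $$\liminf_{n\to\infty}\inf_{\delta n\le s\le h(q_n)-\delta n}\mathbb E_n\big[(\nu^{n,s}_1)_2\mathbf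 1\{\nu^{n,s}_1\le n/(\log n)^{1+\varepsilon}\}\big]>0.$$ *)

(* Defs.v *)
From HB Require Import structures.
From mathcomp Require Import all_boot all_order all_fingroup all_algebra.
From mathcomp Require Import all_classical all_reals all_analysis.

Set Implicit Arguments.
Unset Strict Implicit.
Unset Printing Implicit Defensive.

Import Order.TTheory GRing.Theory Num.Theory.
Import numFieldNormedType.Exports.

Local Open Scope classical_set_scope.
Local Open Scope ring_scope.

(* The infimum is +oo when q never vanishes on the positive integers. *)
Definition hq (R : realType) (q : nat -> nat) : \bar R :=
  ereal_inf [set (i%:R : R)%:E | i in [set i : nat | (0 < i)%N /\ q i = 0%N]].

(* Profiles are indexed by the positive integers: q 0 is never used. *)
Definition discrete_profile (R : realType) (q : nat -> nat) : Prop :=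
  forall s : nat, (0 < s)%N -> (hq R q <= (s%:R : R)%:E)%E -> q s = 0%N.

Definition mutually_independent (R : realType) (d : measure_display)
    (T : measurableType d) (P : probability T R) (I : eqType) (D : set I)
    (d' : measure_display) (E : I -> measurableType d')
    (X : forall i, T -> E i) : Prop :=
  forall (J : seq I) (A : forall i, set (E i)),
    uniq J -> [set` J] `<=` D ->
    (forall i, i \in J -> measurable (A i)) ->
    P (\bigcap_(i in [set` J]) (X i @^-1` A i)) =
      (\big[*%E/1]_(i <- J) P (X i @^-1` A i))%E.

Definition permute_tuple (k : nat) (p : 'S_k) (v : k.-tuple nat) :
    k.-tuple nat :=
  [tuple tnth v (p i) | i < k].

(* Generations are s = 1, 2, ...; q 0 and offspring 0 are unconstrained dummies,
   and coordinates are numbered from 0. *)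
Record cannings_model (R : realType) := CanningsModel {
  cm_display : measure_display;
  cm_space : measurableType cm_display;
  cm_P : probability cm_space R;
  cm_q : nat -> nat;
  cm_nu : forall s : nat, {mfun cm_space >-> (cm_q s).-tuple nat};
  cm_profile : discrete_profile R cm_q;
  cm_sum : forall (s : nat) (w : cm_space), (0 < s)%N ->
    (\sum_(i < cm_q s) tnth (cm_nu s w) i)%N = cm_q s.+1;
  cm_exchangeable : forall (s : nat) (p : 'S_(cm_q s))
      (A : set ((cm_q s).-tuple nat)), (0 < s)%N -> measurable A ->
    cm_P [set w | A (permute_tuple p (cm_nu s w))] =
    cm_P [set w | A (cm_nu s w)];
  cm_independent :
    mutually_independent cm_P [set s | (0 < s)%N] (fun s => cm_nu s) }.

Section model.
Variables (R : realType) (C : cannings_model R).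

Definition hmodel : \bar R := hq R (cm_q C).

(* First coordinate of the offspring vector; it exists as soon as s < hmodel,
   and is read as 0 when the vector is empty. *)
Definition nu1 (s : nat) (w : cm_space C) : nat := nth 0%N (cm_nu C s w) 0.

Definition sigma_model (s : nat) : R :=
  Num.sqrt (if ((s%:R : R)%:E < hmodel)%E
            then fine (variance (cm_P C) (fun w => (nu1 s w)%:R)) else 0).

(* Ulam-Harris encoding of the tree: a vertex is the word of the 0-based birth
   ranks along its ancestral line, so the ancestors of a vertex are its
   prefixes.  [level k w] lists the vertices at height k in lexicographic order;
   [zip] pairs each of them with its number of children. *)
Definition children_numbers (k : nat) (w : cm_space C) : seq nat :=
  if k == 0%N then [:: cm_q C 1] else cm_nu C k w.

Fixpoint level (k : nat) (w : cm_space C) : seq (seq nat) :=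
  if k is k'.+1 then
    flatten [seq [seq rcons u.1 j | j <- iota 0 u.2]
            | u <- zip (level k' w) (children_numbers k' w)]
  else [:: [::]].

Definition nb_with_descendant (a b : nat) (w : cm_space C) : nat :=
  count (fun u => has (fun v => prefix u v) (level b w)) (level a w).

End model.

Section profiles.
Variable R : realType.

Definition hprof (f : R -> R) : \bar R :=
  ereal_inf [set y%:E | y in [set y : R | 0 < y /\ f y = 0]].

(* A function on R_+ is encoded by a function on R; its values at negative
   numbers play no role.  When hprof f = 0 there is nothing to the left of
   hprof f, whence the hypothesis 0 < h. *)
Definition continuous_profile (f : R -> R) : Prop :=
  [/\ forall x : R, 0 <= x -> 0 <= f x,
      forall x : R, 0 <= x -> (hprof f <= x%:E)%E -> f x = 0,
      {within [set x : R | 0 <= x /\ (x%:E < hprof f)%E], continuous f} &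
      forall h : R, 0 < h -> hprof f = h%:E -> cvg (f x @[x --> h^'-]) ].

Section hypotheses.
Variables (C : nat -> cannings_model R) (ell sigma : R -> R).

Definition H1_i : Prop :=
  [/\ (hmodel (C n) * (n%:R^-1)%:E)%E @[n --> \oo] --> hprof ell,
      forall K : set R, compact K ->
        K `<=` [set x | 0 < x /\ (x%:E < hprof ell)%E] ->
        {uniform K, (fun (n : nat) (x : R) =>
           (cm_q (C n) (Num.truncn (n%:R * x)))%:R / n%:R) @ \oo --> ell} &
      forall K : set R, compact K ->
        K `<=` [set x | 0 < x /\ (x%:E < hprof sigma)%E] ->
        {uniform K, (fun (n : nat) (x : R) =>
           sigma_model (C n) (Num.truncn (n%:R * x))) @ \oo --> sigma}].

Definition bulk (n : nat) (delta : R) : set nat :=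
  [set s : nat | ((delta * n%:R)%:E <= (s%:R)%:E)%E /\
                 ((s%:R)%:E <= hmodel (C n) - (delta * n%:R)%:E)%E].

Definition H1_ii : Prop :=
  ereal_sup [set ((n%:R ^- 2)%:E *
      \esum_(s in [set s | (0 < s)%N] `\` bulk n delta)
        ((cm_q (C n) s)%:R : R)%:E)%E | n in [set n : nat | (0 < n)%N]]
    @[delta --> 0^'+] --> 0%E.

(* The limits are taken in the extended reals: the value +oo is allowed. *)
Definition H1_iii : Prop :=
  cvg ((ell s / sigma s ^+ 2)%:E @[s --> 0^'+]) /\
  forall h : R, 0 < h -> hprof ell = h%:E ->
    cvg ((ell s / sigma s ^+ 2)%:E @[s --> h^'-]).

Definition H1 : Prop :=
  [/\ continuous_profile ell, continuous_profile sigma,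
      hprof ell = hprof sigma & (hprof ell < +oo)%E] /\
  [/\ H1_i, H1_ii & H1_iii].

Definition H2a : Prop :=
  forall delta : R, 0 < delta -> exists2 eps : R, 0 < eps &
    (0 < limn_einf (fun n : nat =>
       ereal_inf [set expectation (cm_P (C n)) (fun w =>
           (nu1 s w ^_ 2)%:R *
           (if (nu1 s w)%:R <= n%:R / (ln n%:R) `^ (1 + eps) then 1 else 0))%R
       | s in bulk n delta]))%E.

End hypotheses.
End profiles.

(* Main.v *)
Require Import Defs.
From mathcomp Require Import all_boot all_order all_fingroup all_algebra.
From mathcomp Require Import all_classical all_reals all_analysis.
From mathcomp Require Import measurable_realfun zify ring lra.
Import Order.TTheory GRing.Theory Num.Theory.
Import numFieldNormedType.Exports.

(* Let [D_s] be the set of vertices of height [s] with a descendant at height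
   [b := h^*(n)], so that the variable of interest is the cardinal of [D_a] with
   [a := h_*(n)].  The set [D_s] consists of the parents of [D_(s+1)], which is
   independent of the offspring numbers of generation [s] and whose law is
   invariant under permutations.  A litter of size [v] meeting [D_(s+1)] in [N]
   vertices loses [(N - 1)^+] of them, and a truncated inclusion-exclusion
   formula bounds the mean loss below through the factorial moments of order two
   and three of [N], which exchangeability makes explicit.  With (H2a) this
   yields, for [m_s := E #|D_s|],
     m_s <= m_(s+1) - (C / n) * (2 * t * (m_(s+1) - 1) - t ^+ 2)
   for every [t] between [0] and [L / 2], where [L] is of order
   [(ln n) ^ (1 + eps)].  Taking [t = L / 2] brings [m_s - 1] from order [n] down
   to [L / 2] in [o(n)] generations; then taking [t = m_(s+1) - 1], as in the
   descent from infinity of Kingman's coalescent, makes it bounded after order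
   [n] more generations.  Markov's inequality concludes. *)

Set Implicit Arguments.
Unset Strict Implicit.
Unset Printing Implicit Defensive.

Local Open Scope ring_scope.

(** * Exchangeable random sets *)

(** Equal fibre sizes mean that the tuples of values have the same multiplicities, hence are
    rearrangements of one another. *)
Lemma perm_of_eq_card_fibers (n : nat) (T : eqType) (f g : 'I_n -> T) :
  (forall x, #|[pred i | f i == x]| = #|[pred i | g i == x]|) ->
  exists s : 'S_n, forall i, f i = g (s i).
Proof.
move=> fg.
have /tuple_permP[s sE] : perm_eq [tuple f i | i < n] [tuple g i | i < n].
  apply/allP => x _ /=; apply/eqP; rewrite !count_map.
  by have := fg x; rewrite !cardE /enum_mem !size_filter.
exists s => i; have := congr1 (fun t => tnth t i) (val_inj sE).
by rewrite !tnth_mktuple.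
Qed.

Lemma perm_imset_of_eq_card (n : nat) (A B : {set 'I_n}) :
  #|A| = #|B| -> exists s : 'S_n, s @: A = B.
Proof.
move=> AB.
have E (C : {set 'I_n}) (x : bool) :
    #|[pred i | (i \in C) == x]| = (if x then #|C| else n - #|C|)%N.
  case: x; first by apply: eq_card => i; rewrite !inE eqb_id.
  have <- : #|[predC C]| = (n - #|C|)%N.
    exact: canRL (addKn _) (etrans (cardC _) (card_ord n)).
  by apply: eq_card => i; rewrite !inE eqbF_neg.
have [|s sE] := @perm_of_eq_card_fibers n _ (fun i => i \in A) (fun i => i \in B).
  by move=> x; rewrite !E AB.
exists s; apply/eqP; rewrite eqEcard card_imset ?AB ?leqnn ?andbT; last exact: perm_inj.
by apply/fintype.subsetP => _ /imsetP[x xA ->]; rewrite -sE.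
Qed.

(* [None] is a junk value, for [j] beyond the total of the offspring numbers. *)
Definition parent (q Q : nat) (v : q.-tuple nat) (j : 'I_Q) : option 'I_q :=
  insub (reshape_index v j).

Definition parents (q Q : nat) (v : q.-tuple nat) (S : {set 'I_Q}) :
    {set 'I_q} :=
  [set i | [exists j in S, parent v j == Some i]]%SET.

Definition litter (q Q : nat) (v : q.-tuple nat) (i : 'I_q) : {set 'I_Q} :=
  [set j | parent v j == Some i]%SET.

(** Children are numbered from left to right, so litters are consecutive blocks: the first [x]
    numbers fall in block [0], and the others repeat the picture for the tail, shifted by one
    block. *)
Lemma count_reshape_index (v : seq nat) (i : nat) :
  count (fun j => reshape_index v j == i) (iota 0 (sumn v)) = nth 0%N v i.
Proof.
elim: v i => [|x v IH] i; first by rewrite nth_nil.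
rewrite /= iotaD count_cat add0n -[X in iota X (sumn v)]addn0 iotaDl count_map.
have E1 j : (j < x)%N -> reshape_index (x :: v) j = 0%N.
  by move=> jx; rewrite /reshape_index /= subn_eq0 jx.
have E2 j : reshape_index (x :: v) (x + j) = (reshape_index v j).+1.
  by rewrite /reshape_index /= -addnS addKn; case: eqP => //; lia.
have -> : count (fun j => reshape_index (x :: v) j == i) (iota 0 x) =
    (x * (i == 0))%N.
  rewrite (eq_in_count (a2 := fun=> 0%N == i)).
    case: i => [|i]; first by rewrite count_predT size_iota muln1.
    by rewrite count_pred0 muln0.
  by move=> j; rewrite mem_iota add0n => /andP[_ jx]; rewrite E1.
under eq_count do rewrite /= E2.
case: i => [|i] /=; first by rewrite muln1 count_pred0 addn0.
by rewrite muln0 add0n -IH; apply: eq_count => j /=; rewrite eqSS.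
Qed.

Lemma sumn_tuple (q : nat) (v : q.-tuple nat) :
  sumn v = (\sum_(i < q) tnth v i)%N.
Proof. by rewrite sumnE big_tuple. Qed.

Lemma parent_eqE (q Q : nat) (v : q.-tuple nat) (j : 'I_Q) (i : 'I_q) :
  (parent v j == Some i) = (reshape_index v j == i).
Proof.
rewrite /parent; case: insubP => [u _ <- //|]; rewrite -leqNgt => h.
by apply/esym/negbTE; rewrite neq_ltn (leq_trans (ltn_ord i) h) orbT.
Qed.

Lemma card_litter (q Q : nat) (v : q.-tuple nat) (i : 'I_q) :
  (\sum_(i < q) tnth v i)%N = Q -> #|litter Q v i| = tnth v i.
Proof.
move=> vQ; rewrite (tnth_nth 0%N) -count_reshape_index sumn_tuple vQ.
rewrite cardE size_filter -val_enum_ord count_map /enum_mem filter_predT.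
by apply: eq_count => j /=; rewrite inE parent_eqE.
Qed.

Lemma parent_isSome (q Q : nat) (v : q.-tuple nat) (j : 'I_Q) :
  (\sum_(i < q) tnth v i)%N = Q -> parent v j.
Proof.
move=> vQ; rewrite /parent; case: insubP => //.
by have := @reshape_indexP v j; rewrite size_tuple sumn_tuple vQ ltn_ord => ->.
Qed.

Definition card_invariant (R : Type) (n : nat) (mu : {set 'I_n} -> R) :=
  forall S S' : {set 'I_n}, #|S| = #|S'| -> mu S = mu S'.

(* Both sides count the pairs of [j]-sets [A], [B] with [A] included in [F],
   weighted by the mass of the sets containing [A]. *)
Lemma sum_bin_cardI (R : realType) (n : nat) (mu : {set 'I_n} -> R)
    (F : {set 'I_n}) (j : nat) :
  card_invariant mu ->
  'C(n, j)%:R * (\sum_S mu S * 'C(#|S :&: F|, j)%:R) =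
  'C(#|F|, j)%:R * (\sum_S mu S * 'C(#|S|, j)%:R).
Proof.
move=> muP.
pose c (A : {set 'I_n}) : R := \sum_S mu S * (A \subset S)%:R.
pose draws (F : {set 'I_n}) := [set A : {set 'I_n} | (A \subset F) && (#|A| == j)]%SET.
(* A permutation taking [A] to [B] matches the supersets of [A] with those of [B] and keeps their
   cardinals, hence their masses. *)
have cP (A B : {set 'I_n}) : #|A| = #|B| -> c A = c B.
  move=> /perm_imset_of_eq_card[s sAB].
  rewrite /c [RHS](reindex_inj (imset_inj (@perm_inj _ s))) /=.
  apply: eq_bigr => S _; rewrite -sAB (muP _ (s @: S)%SET).
    congr (_ * (nat_of_bool _)%:R); apply/idP/idP; first exact: imsetS.
    move=> /fintype.subsetP AS; apply/fintype.subsetP => x xA.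
    by have /imsetP[y yS /perm_inj ->] := AS _ (imset_f s xA).
  by rewrite card_imset//; exact: perm_inj.
have ME (G : {set 'I_n}) : \sum_S mu S * 'C(#|S :&: G|, j)%:R = \sum_(A in draws G) c A.
  rewrite exchange_big /=; apply: eq_bigr => S _; rewrite -mulr_sumr.
  congr (_ * _); rewrite -cards_draws -sum1_card natr_sum big_mkcond /=.
  rewrite [RHS]big_mkcond /=; apply: eq_bigr => A _.
  by rewrite !inE finset.subsetI; case: (A \subset S); case: (A \subset G); case: (_ == _).
have ME' : \sum_S mu S * 'C(#|S|, j)%:R = \sum_(A in draws [set: 'I_n]%SET) c A.
  by rewrite -ME; apply: eq_bigr => S _; rewrite finset.setIT.
rewrite ME ME'.
transitivity (\sum_(B in draws [set: 'I_n]%SET) \sum_(A in draws F) c A).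
  by rewrite sumr_const cards_draws cardsT card_ord mulr_natl.
transitivity (\sum_(A in draws F) \sum_(B in draws [set: 'I_n]%SET) c B); last first.
  by rewrite sumr_const cards_draws mulr_natl.
rewrite exchange_big /=; apply: eq_bigr => A; rewrite inE => /andP[_ /eqP Aj].
by apply: eq_bigr => B; rewrite inE => /andP[_ /eqP Bj]; apply: cP; rewrite Aj Bj.
Qed.

(** * Truncated inclusion-exclusion for one litter *)

Lemma mul_bin2 (R : realType) (n : nat) :
  2 * 'C(n, 2)%:R = n%:R * (n%:R - 1) :> R.
Proof.
have := mul_bin_left n 1; rewrite bin1 => /(congr1 (fun k => k%:R : R)).
rewrite !natrM => ->; case: n => [|n]; first by rewrite !mul0r.
by rewrite subSS subn0 -natr1 addrK mulrC.
Qed.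

Lemma mul_bin3 (R : realType) (n : nat) :
  3 * 'C(n, 3)%:R = (n%:R - 2) * 'C(n, 2)%:R :> R.
Proof.
have := mul_bin_left n 2 => /(congr1 (fun k => k%:R : R)); rewrite !natrM => ->.
case: n => [|[|n]]; [by rewrite bin_small// !mulr0 | by rewrite bin_small// !mulr0 |].
by rewrite subSS subSS subn0 -addn2 natrD addrK.
Qed.

(* With [x := a * N], this is [2 * x - x ^+ 2 <= 1]. *)
Lemma has_le_bin (R : realType) (a : R) (N : nat) : 0 <= a -> a <= 2^-1 ->
  (0 < N)%N%:R <=
  N%:R - (2 * a * 'C(N, 2)%:R - 6 * a ^+ 2 * 'C(N, 3)%:R) :> R.
Proof.
have := mul_bin2 R N; have := mul_bin3 R N.
case: N => [|N] E3 E2 a0 a2; first by rewrite /= !mulr0 !subr0.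
have -> : 6 * a ^+ 2 * 'C(N.+1, 3)%:R = a ^+ 2 * ((N%:R - 1) * (N.+1%:R * N%:R)).
  have -> : 6 * a ^+ 2 * 'C(N.+1, 3)%:R = a ^+ 2 * (2 * (3 * 'C(N.+1, 3)%:R)).
    by ring.
  by rewrite E3 [2 * (_ * _)]mulrCA E2 -natr1; ring.
have -> : 2 * a * 'C(N.+1, 2)%:R = a * (N.+1%:R * N%:R).
  by rewrite -mulrA mulrCA E2 -natr1; ring.
rewrite -natr1 /=; have N0 : 0 <= N%:R :> R by rewrite ler0n.
rewrite -subr_ge0 [leRHS](_ : _ = N%:R * ((1 - a * (N%:R + 1)) ^+ 2 +
  a * (N%:R + 1) * (1 - 2 * a))); last by ring.
rewrite mulr_ge0// addr_ge0 ?sqr_ge0// mulr_ge0 ?mulr_ge0 ?subr_ge0 ?addr_ge0//.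
by rewrite -ler_pdivlMl// mulr1.
Qed.

(** Since ['C(m, 3)] is [(m - 2) / 3] times ['C(m, 2)], the quotient of the two sides is
    [2 * a * (v - 2) * (k - 2) / (Q - 2)], and [(v - 2) / (Q - 2) <= v / Q] because [v <= Q]. *)
Lemma bin3_ratio_le (R : realType) (a : R) (v k Q : nat) :
  0 <= a -> (v <= Q)%N -> (2 < Q)%N -> 2 * a * k%:R * v%:R <= Q%:R ->
  6 * a * ('C(v, 3)%:R / 'C(Q, 3)%:R) * 'C(k, 3)%:R <=
  'C(v, 2)%:R / 'C(Q, 2)%:R * 'C(k, 2)%:R.
Proof.
move=> a0 vQ Q2 akv.
have [v2|v2] := ltnP v 2.
  by rewrite !(@bin_small v)//; [rewrite !mul0r !mulr0 !mul0r|lia].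
have [k2|k2] := ltnP k 2.
  by rewrite !(@bin_small k)//; [rewrite !mulr0|lia].
have thirds m : 'C(m, 3)%:R = (m%:R - 2) * 'C(m, 2)%:R / 3 :> R.
  by rewrite -mul_bin3 mulrC mulKf// pnatr_eq0.
have Q2' : 0 < Q%:R - 2 :> R by rewrite subr_gt0 ltr_nat.
have C0 : 0 < 'C(Q, 2)%:R :> R by rewrite ltr0n bin_gt0; lia.
have v2' : 0 <= v%:R - 2 :> R by rewrite subr_ge0 ler_nat.
have k2' : 0 <= k%:R - 2 :> R by rewrite subr_ge0 ler_nat.
have vQ' : v%:R <= Q%:R :> R by rewrite ler_nat.
rewrite [leLHS](_ : _ = 2 * a * (v%:R - 2) * (k%:R - 2) / (Q%:R - 2) *
    ('C(v, 2)%:R / 'C(Q, 2)%:R * 'C(k, 2)%:R)); last first.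
  by rewrite !thirds; field; rewrite !lt0r_neq0.
rewrite -[leRHS]mul1r ler_wpM2r//.
rewrite ler_pdivrMr// mul1r.
rewrite -(@ler_pM2r _ Q%:R); last lra.
apply: (@le_trans _ _ (2 * a * k%:R * v%:R * (Q%:R - 2))).
  have -> : 2 * a * (v%:R - 2) * (k%:R - 2) * Q%:R =
    2 * a * ((v%:R - 2) * (k%:R - 2) * Q%:R) by ring.
  have -> : 2 * a * k%:R * v%:R * (Q%:R - 2) =
    2 * a * (k%:R * v%:R * (Q%:R - 2)) by ring.
  rewrite ler_wpM2l//; first by rewrite mulr_ge0.
  nra.
by rewrite mulrC ler_wpM2l// ltW.
Qed.

Lemma card_parents (q Q : nat) (v : q.-tuple nat) (S : {set 'I_Q}) :
  #|parents v S| = (\sum_i (0 < #|S :&: litter Q v i|))%N.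
Proof.
rewrite -sum1_card big_mkcond /=; apply: eq_bigr => i _; rewrite inE.
have -> : [exists j in S, parent v j == Some i] = (0 < #|S :&: litter Q v i|)%N.
  rewrite finset.card_gt0; apply/existsP/set0Pn => -[j].
    by move=> /andP[jS ji]; exists j; rewrite !inE jS.
  by rewrite !inE => /andP[jS ji]; exists j; rewrite jS.
by case: (0 < _)%N.
Qed.

Lemma sum_card_litter (q Q : nat) (v : q.-tuple nat) (S : {set 'I_Q}) :
  (\sum_(i < q) tnth v i)%N = Q ->
  #|S| = (\sum_i #|S :&: litter Q v i|)%N.
Proof.
move=> vQ; rewrite -sum1_card.
under [RHS]eq_bigr do rewrite -sum1_card big_mkcond.
rewrite exchange_big big_mkcond /=; apply: eq_bigr => j _.
have := parent_isSome j vQ; case E : (parent v j) => [i|//] _.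
rewrite (bigD1 i)//= big1 ?addn0; first by rewrite !inE E eqxx andbT.
move=> i' /negbTE ii'; rewrite !inE E.
by have -> : (Some i == Some i') = (i == i') by []; rewrite eq_sym ii' andbF.
Qed.

(* Thinning the pair count by this factor keeps the third-order correction
   below half of the main term when litters have at most [Q / L] members. *)
Definition thinning (R : realType) (L : R) (k : nat) : R :=
  Num.min 2^-1 (L / (2 * k%:R)).

Lemma thinning_ge0 (R : realType) (L : R) (k : nat) :
  0 <= L -> 0 <= thinning L k.
Proof. by move=> L0; rewrite le_min invr_ge0 ler0n divr_ge0// mulr_ge0. Qed.

(** Litter by litter, [has_le_bin] with [a := thinning L #|S|] bounds the indicator that the parent
    is kept, [sum_bin_cardI] evaluates the moments, and the third-order term consumes at most half
    of the second-order one. Litters larger than [V] get only the trivial bound. *)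
Lemma mean_card_parents_le (R : realType) (q Q : nat) (v : q.-tuple nat)
    (mu : {set 'I_Q} -> R) (L V : R) :
  (\sum_(i < q) tnth v i)%N = Q -> (2 < Q)%N ->
  (forall S, 0 <= mu S) -> card_invariant mu -> 0 <= L -> L * V <= Q%:R ->
  \sum_S mu S * #|parents v S|%:R <= \sum_S mu S * #|S|%:R -
    (\sum_i ((tnth v i)%:R <= V)%R%:R * ('C(tnth v i, 2)%:R / 'C(Q, 2)%:R)) *
    \sum_S mu S * (thinning L #|S| * 'C(#|S|, 2)%:R).
Proof.
move=> vQ Q2 mu0 muP L0 LV.
have C20 : 0 < 'C(Q, 2)%:R :> R by rewrite ltr0n bin_gt0; lia.
have C30 : 0 < 'C(Q, 3)%:R :> R by rewrite ltr0n bin_gt0; lia.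
under eq_bigr do rewrite card_parents natr_sum mulr_sumr.
under [X in _ <= X - _]eq_bigr do rewrite (sum_card_litter _ vQ) natr_sum mulr_sumr.
rewrite exchange_big [X in _ <= X - _]exchange_big /= mulr_suml -sumrB.
apply: ler_sum => i _; set N := fun S => #|S :&: litter Q v i|.
set b := fun k => thinning L k.
have [vV|_] := boolP (_ <= V); last first.
  rewrite !mul0r subr0; apply: ler_sum => S _; rewrite ler_wpM2l// ler_nat.
  by case: #|_|.
have vQ' : (tnth v i <= Q)%N by rewrite -vQ (bigD1 i)//= leq_addr.
(* The weight [w #|S|] is absorbed into [mu], which stays invariant. *)
have sum_bin (w : nat -> R) j : 0 < 'C(Q, j)%:R :> R ->
    \sum_S mu S * (w #|S| * 'C(N S, j)%:R) =
    'C(tnth v i, j)%:R / 'C(Q, j)%:R * \sum_S mu S * (w #|S| * 'C(#|S|, j)%:R).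
  move=> C0; have wP : card_invariant (fun S : {set 'I_Q} => mu S * w #|S|).
    by move=> S S' SS'; rewrite SS' (muP _ _ SS').
  have := sum_bin_cardI (litter Q v i) j wP; rewrite card_litter//.
  under eq_bigr do rewrite -mulrA; under [in RHS]eq_bigr do rewrite -mulrA.
  by move=> E; rewrite mulrAC -E mulrAC mulfV ?mul1r ?lt0r_neq0.
apply: (@le_trans _ _ (\sum_S mu S * (N S)%:R -
   (\sum_S mu S * (2 * b #|S| * 'C(N S, 2)%:R) -
    \sum_S mu S * (6 * b #|S| ^+ 2 * 'C(N S, 3)%:R)))).
  rewrite -!sumrB; apply: ler_sum => S _; rewrite -!mulrBr ler_wpM2l//.
  by apply: has_le_bin; [exact: thinning_ge0 | rewrite ge_min lexx].
rewrite (sum_bin (fun k => 2 * b k))// (sum_bin (fun k => 6 * b k ^+ 2))//.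
rewrite lerB// mul1r -subr_ge0 !mulr_sumr -!sumrB sumr_ge0// => S _.
set r2 := 'C(_, 2)%:R / _; set r3 := 'C(_, 3)%:R / _.
have -> : r2 * (mu S * (2 * b #|S| * 'C(#|S|, 2)%:R)) -
     r3 * (mu S * (6 * b #|S| ^+ 2 * 'C(#|S|, 3)%:R)) -
     r2 * (mu S * (b #|S| * 'C(#|S|, 2)%:R)) =
  mu S * (b #|S| * (r2 * 'C(#|S|, 2)%:R - 6 * b #|S| * r3 * 'C(#|S|, 3)%:R)).
  by ring.
rewrite !mulr_ge0 ?thinning_ge0// subr_ge0 bin3_ratio_le ?thinning_ge0//.
have [S0|S0] := posnP #|S|; first by rewrite S0 mulr0 mul0r.
(* [2 * thinning L k * k <= L] by the second argument of the minimum, and the litter has at most [V]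
   members. *)
apply: le_trans LV; rewrite ler_pM ?mulr_ge0 ?thinning_ge0//.
rewrite mulrAC mulrC -ler_pdivlMr ?mulr_gt0 ?ltr0n//.
by rewrite ge_min lexx orbT.
Qed.

(** * Passing from a random set to its set of parents *)

Definition numbers (q Q : nat) (v : q.-tuple 'I_Q.+1) : q.-tuple nat :=
  map_tuple (@nat_of_ord Q.+1) v.

Lemma numbers_inj (q Q : nat) : injective (@numbers q Q).
Proof.
move=> v v' /(congr1 val) /= vv'; apply: val_inj => /=.
exact: inj_map val_inj _ _ vv'.
Qed.

Definition permute (T : Type) (q : nat) (s : 'S_q) (v : q.-tuple T) : q.-tuple T :=
  [tuple tnth v (s i) | i < q].

Lemma permute_inj (T : Type) (q : nat) (s : 'S_q) : injective (@permute T q s).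
Proof.
move=> v v' vv'; apply: eq_from_tnth => i.
have := congr1 (fun t => tnth t ((s^-1)%g i)) vv'.
by rewrite !tnth_mktuple permKV.
Qed.

Lemma permute_numbers (q Q : nat) (s : 'S_q) (v : q.-tuple 'I_Q.+1) :
  numbers (permute s v) = permute_tuple s (numbers v).
Proof.
by apply: eq_from_tnth => i; rewrite !tnth_mktuple tnth_map tnth_mktuple tnth_map.
Qed.

Lemma sum_permute_tuple (q : nat) (s : 'S_q) (v : q.-tuple nat) :
  (\sum_(i < q) tnth (permute_tuple s v) i)%N = (\sum_(i < q) tnth v i)%N.
Proof.
under eq_bigr do rewrite tnth_mktuple.
by rewrite [RHS](reindex_inj (@perm_inj _ s)).
Qed.

(** Litter [i] of the permuted vector and litter [s i] of [v] have the same size, so some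
    renumbering [t] of the children carries each of the former onto the latter. *)
Lemma parents_permute (q Q : nat) (s : 'S_q) (v : q.-tuple nat) :
  (\sum_(i < q) tnth v i)%N = Q ->
  exists t : 'S_Q, forall S : {set 'I_Q},
    parents v (t @: S)%SET = (s @: parents (permute_tuple s v) S)%SET.
Proof.
move=> vQ; have svQ := etrans (sum_permute_tuple s v) vQ.
have [|t tE] := @perm_of_eq_card_fibers Q _
    (fun j => omap s (parent (permute_tuple s v) j)) (parent v).
  (* The fibre over [None] is empty on both sides: every child has a parent. *)
  case=> [i|]; last first.
    apply: eq_card => j; rewrite !inE.
    have := parent_isSome j vQ; have := parent_isSome j svQ.
    by case: (parent _ _) => // k _; case: (parent _ _).
  transitivity #|litter Q v i|; last by apply: eq_card => j; rewrite !inE.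
  rewrite card_litter// -{1}(permKV s i).
  transitivity (tnth (permute_tuple s v) ((s^-1)%g i)); last first.
    by rewrite tnth_mktuple permKV.
  rewrite -(card_litter _ svQ); apply: eq_card => j; rewrite !inE.
  case: (parent _ _) => //= k; apply/eqP/eqP => [[/perm_inj ->]//|[->]//].
exists t => S; apply/setP => i; apply/idP/idP.
  rewrite inE => /existsP[_ /andP[/imsetP[j jS ->]]]; rewrite -tE.
  case E : (parent _ j) => [k|//] /eqP[<-]; apply: imset_f.
  by rewrite inE; apply/existsP; exists j; rewrite jS E eqxx.
move=> /imsetP[k]; rewrite !inE => /existsP[j /andP[jS /eqP jk]] ->.
by apply/existsP; exists (t j); rewrite imset_f// -tE jk /= eqxx.
Qed.

(** The law of the set of parents when the offspring vector, of law [p], and the set of children, of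
    law [mu], are independent. *)
Definition parents_law (R : pzRingType) (q Q : nat) (p : q.-tuple 'I_Q.+1 -> R)
    (mu : {set 'I_Q} -> R) (S : {set 'I_q}) : R :=
  \sum_v \sum_S' p v * mu S' * (parents (numbers v) S' == S)%:R.

Section parents_law.
Variables (R : realType) (q Q : nat) (p : q.-tuple 'I_Q.+1 -> R).
Variable mu : {set 'I_Q} -> R.
Hypothesis p0 : forall v, 0 <= p v.
Hypothesis pQ : forall v, p v != 0 -> (\sum_(i < q) tnth (numbers v) i)%N = Q.
Hypothesis p1 : \sum_v p v = 1.
Hypothesis pP : forall s v, p (permute s v) = p v.
Hypothesis mu0 : forall S, 0 <= mu S.
Hypothesis mu1 : \sum_S mu S = 1.
Hypothesis muP : card_invariant mu.

Lemma sum_parents_law (f : {set 'I_q} -> R) :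
  \sum_S parents_law p mu S * f S =
  \sum_v p v * \sum_S mu S * f (parents (numbers v) S).
Proof.
under eq_bigr do rewrite mulr_suml; rewrite exchange_big; apply: eq_bigr => v _.
under eq_bigr do rewrite mulr_suml; rewrite exchange_big mulr_sumr.
apply: eq_bigr => S _; rewrite (bigD1 (parents (numbers v) S))//= eqxx mulr1.
rewrite big1 ?addr0 ?mulrA// => S' /negbTE SS'.
by rewrite eq_sym SS' mulr0 mul0r.
Qed.

(** A permutation of the parents is undone by exchangeability of [p], at the price of a renumbering
    of the children. The latter varies with [v], but for each [v] the invariance of [mu] absorbs
    it. *)
Lemma parents_law_card_invariant : card_invariant (parents_law p mu).
Proof.
move=> S1 S2 /perm_imset_of_eq_card[s <-].
rewrite /parents_law (reindex_inj (@permute_inj _ _ s)).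
apply: eq_bigr => v _; rewrite pP.
have [->|/pQ vQ] := eqVneq (p v) 0.
  by rewrite !big1// => S' _; rewrite !mul0r.
have [t tE] := parents_permute s vQ.
rewrite [RHS](reindex_inj (imset_inj (@perm_inj _ t))); apply: eq_bigr => S _.
rewrite tE (inj_eq (imset_inj (@perm_inj _ s))) permute_numbers.
by rewrite (muP (S' := S))// card_imset//; exact: perm_inj.
Qed.

Lemma sum_tnth (f : nat -> R) (i j : 'I_q) :
  \sum_v p v * f (tnth (numbers v) i) = \sum_v p v * f (tnth (numbers v) j).
Proof.
rewrite (reindex_inj (@permute_inj _ _ (tperm i j))); apply: eq_bigr => v _.
by rewrite pP permute_numbers tnth_mktuple tpermL.
Qed.

(** The right side is [Num.min k L * (k - 1)]; the left side is the tangent at [t] to the square of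
    [k - 1]. Being affine in [k], this lower bound can be averaged and then involves only the
    mean. *)
Lemma thinned_pairs_ge (L t : R) (k : nat) : 0 <= t <= L / 2 ->
  2 * t * (k%:R - 1) - t ^+ 2 <= 4 * (thinning L k * 'C(k, 2)%:R).
Proof.
move=> /andP[t0 tL]; have L0 : 0 <= L by lra.
have -> : 4 * (thinning L k * 'C(k, 2)%:R) = 2 * (thinning L k * k%:R) * (k%:R - 1).
  by rewrite -!mulrA -mul_bin2; ring.
have [->|k0] := posnP k; first by rewrite mulr0 mulr0 mul0r; nra.
have k1 : 1 <= k%:R :> R by rewrite ler1n.
rewrite /thinning minEle; case: ifP => [_|/negbT].
  by have := sqr_ge0 (k%:R - 1 - t); rewrite mulVKf ?pnatr_eq0//; nra.
rewrite -ltNge => h.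
have -> : L / (2 * k%:R) * k%:R = L / 2 by field; rewrite gt_eqF// ltr0n.
by nra.
Qed.

(** Average [mean_card_parents_le] over [v]. The [4] comes from [thinned_pairs_ge], and [Q ^+ 2]
    from weakening [Q * (Q - 1)]. *)
Lemma mean_parents_law_le (i0 : 'I_q) (L V c t : R) : (2 < Q)%N ->
  0 <= t <= L / 2 -> L * V <= Q%:R -> 0 <= c ->
  c <= \sum_v p v * ((tnth (numbers v) i0 ^_ 2)%:R *
         ((tnth (numbers v) i0)%:R <= V)%R%:R) ->
  \sum_S parents_law p mu S * #|S|%:R <=
  \sum_S mu S * #|S|%:R - c * q%:R / (4 * Q%:R ^+ 2) *
    (2 * t * (\sum_S mu S * #|S|%:R - 1) - t ^+ 2).
Proof.
move=> Q2 tL LV c0 cE; have L0 : 0 <= L by lra.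
set m := \sum_S mu S * _; set A := \sum_S mu S * (thinning L #|S| * 'C(#|S|, 2)%:R).
have A0 : 0 <= A by apply: sumr_ge0 => S _; rewrite !mulr_ge0 ?thinning_ge0.
have AE : 2 * t * (m - 1) - t ^+ 2 <= 4 * A.
  have -> : 2 * t * (m - 1) - t ^+ 2 =
      \sum_S mu S * (2 * t * (#|S|%:R - 1) - t ^+ 2).
    have -> : 2 * t * (m - 1) - t ^+ 2 = 2 * t * m - (2 * t + t ^+ 2) by ring.
    transitivity (2 * t * m - (2 * t + t ^+ 2) * \sum_S mu S).
      by rewrite mu1; ring.
    by rewrite !mulr_sumr -sumrB; apply: eq_bigr => S _; ring.
  rewrite mulr_sumr; apply: ler_sum => S _; rewrite mulrCA ler_wpM2l//.
  exact: thinned_pairs_ge.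
pose e := \sum_v p v * \sum_i ((tnth (numbers v) i)%:R <= V)%R%:R *
  ('C(tnth (numbers v) i, 2)%:R / 'C(Q, 2)%:R).
(* By exchangeability each of the [q] litters contributes as much as litter [i0]. *)
have eE : c * q%:R / (Q%:R * (Q%:R - 1)) <= e.
  pose f k : R := (k%:R <= V)%R%:R * ('C(k, 2)%:R / 'C(Q, 2)%:R).
  have -> : e = q%:R * \sum_v p v * f (tnth (numbers v) i0).
    rewrite /e; under eq_bigr do rewrite mulr_sumr; rewrite exchange_big /=.
    under eq_bigr do rewrite (sum_tnth f _ i0).
    by rewrite sumr_const card_ord mulr_natl.
  rewrite mulrAC mulrC ler_wpM2l// -mul_bin2.
  have C0 : 0 < 'C(Q, 2)%:R :> R by rewrite ltr0n bin_gt0; lia.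
  rewrite ler_pdivrMr ?mulr_gt0//; apply: (le_trans cE); rewrite mulr_suml.
  apply: ler_sum => v _; rewrite -mulrA ler_wpM2l// /f -bin_ffact -[2`!]/2%N natrM.
  rewrite le_eqVlt; apply/orP; left; apply/eqP; field; exact: lt0r_neq0.
have Q2' : 2 < Q%:R :> R by rewrite ltr_nat.
have -> : c * q%:R / (4 * Q%:R ^+ 2) = c * q%:R / Q%:R ^+ 2 / 4.
  by field; lra.
apply: (@le_trans _ _ (m - e * A)); last first.
  rewrite lerB//; apply: (@le_trans _ _ (c * q%:R / Q%:R ^+ 2 / 4 * (4 * A))).
    by rewrite ler_wpM2l// !mulr_ge0// invr_ge0 exprn_ge0.
  rewrite mulrA divfK// ler_wpM2r//; apply: le_trans eE.
  rewrite ler_wpM2l ?mulr_ge0// lef_pV2 ?posrE ?exprn_gt0 ?mulr_gt0; nra.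
have -> : m = \sum_v p v * m by rewrite -mulr_suml p1 mul1r.
rewrite sum_parents_law /e mulr_suml -sumrB.
apply: ler_sum => v _; rewrite -mulrA -mulrBr.
have [->|/pQ vQ] := eqVneq (p v) 0; first by rewrite !mul0r.
by rewrite ler_wpM2l//; exact: mean_card_parents_le.
Qed.

End parents_law.

(** * The law of the surviving lines *)

Local Open Scope classical_set_scope.
Local Open Scope ring_scope.

Section discrete.
Context (d : measure_display) (T : measurableType d) (R : realType).
Variable P : probability T R.

Definition pr (E : set T) : R := fine (P E).

Lemma pr_EFin (E : set T) : measurable E -> P E = (pr E)%:E.
Proof. by move=> mE; rewrite fineK// fin_num_measure. Qed.

Lemma pr_ge0 (E : set T) : 0 <= pr E.
Proof. exact: fine_ge0. Qed.

Variables (F : finType) (g : T -> F).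
Hypothesis mg : forall x, measurable (g @^-1` [set x]).

Lemma measurable_preimage_fin (A : set F) : measurable (g @^-1` A).
Proof.
rewrite (_ : g @^-1` A = \bigcup_(x in A) (g @^-1` [set x])).
  exact: fin_bigcup_measurable.
by apply/seteqP; split => [w Aw|w [x Ax /= ->]]; [exists (g w)|].
Qed.

Lemma pr_partition (E : set T) : measurable E ->
  pr E = \sum_x pr (E `&` g @^-1` [set x]).
Proof.
move=> mE; have mEx x : measurable (E `&` g @^-1` [set x]) by exact: measurableI.
apply: EFin_inj; rewrite -sumEFin -pr_EFin//.
under eq_bigr do rewrite -pr_EFin//.
have {1}-> : E = \bigcup_(x in [set` enum F]) (E `&` g @^-1` [set x]).
  apply/seteqP; split => [w Ew|w [x _ []//]].
  by exists (g w); rewrite /= ?mem_enum.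
rewrite measure_fin_bigcup//=.
- by rewrite -fsbig_seq ?enum_uniq// big_enum.
- by move=> x y _ _ [w [[_ <-] [_ <-]]].
Qed.

Lemma expectation_fin (f : F -> R) : (forall x, 0 <= f x) ->
  expectation P (f \o g) = (\sum_x pr (g @^-1` [set x]) * f x)%:E.
Proof.
move=> f0; rewrite unlock.
transitivity (\int[P]_w (\sum_(x : F) ((f x)%:E * (\1_(g @^-1` [set x]) w)%:E)))%E.
  apply: eq_integral => w _.
  rewrite (bigD1 (g w))//= indicE mem_set//= mule1 big1 ?adde0// => x xw.
  by rewrite indicE memNset ?mule0// => wx; rewrite wx eqxx in xw.
have m1 x : measurable_fun setT (fun w => (\1_(g @^-1` [set x]) w)%:E : \bar R).
  by apply/measurable_EFinP; exact: measurable_indic.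
rewrite ge0_integral_sum//=; last 2 first.
- by move=> x; apply: emeasurable_funM => //; exact: measurable_cst.
- by move=> x w _; rewrite mule_ge0// lee_fin.
rewrite -sumEFin; apply: eq_bigr => x _.
rewrite ge0_integralZl//=; last by rewrite lee_fin.
by rewrite integral_indic// setIT muleC EFinM -pr_EFin.
Qed.

End discrete.

Lemma measurable_tuple_nat1 (q : nat) (v : q.-tuple nat) : measurable [set v].
Proof.
rewrite (_ : [set v] = \bigcap_(i in [set: 'I_q]) (@tnth _ _ ^~ i @^-1` [set tnth v i])).
  apply: fin_bigcap_measurable => // i _.
  by rewrite -[X in measurable X]setTI; exact: measurable_tnth.
apply/seteqP; split => [w -> //|w vw]; apply: eq_from_tnth => i; exact: vw.
Qed.

Section model.
Variables (R : realType) (M : cannings_model R).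
Notation P := (cm_P M).
Notation q := (cm_q M).
Notation T := (cm_space M).

(** Bounded entries make the vectors range over a finite type, so that laws become finite sums. For
    [s > 0], [inord] alters nothing, since an offspring number is at most the size of the next
    generation. *)
Definition offspring (s : nat) (w : T) : (q s).-tuple 'I_(q s.+1).+1 :=
  map_tuple inord (cm_nu M s w).

Lemma numbers_offspring (s : nat) (w : T) : (0 < s)%N ->
  numbers (offspring s w) = cm_nu M s w.
Proof.
move=> s0; apply: eq_from_tnth => i; rewrite !tnth_map inordK// ltnS.
by rewrite -(cm_sum w s0) (bigD1 i)//= leq_addr.
Qed.

Lemma offspring_eqE (s : nat) (w : T) (v : (q s).-tuple 'I_(q s.+1).+1) :
  (0 < s)%N -> (offspring s w = v) <-> (cm_nu M s w = numbers v).
Proof.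
move=> s0; rewrite -numbers_offspring//; split => [->//|]; exact: numbers_inj.
Qed.

Lemma preimage_offspring (s : nat) (v : (q s).-tuple 'I_(q s.+1).+1) :
  (0 < s)%N -> offspring s @^-1` [set v] = cm_nu M s @^-1` [set numbers v].
Proof. by move=> s0; apply/seteqP; split => w /=; rewrite offspring_eqE. Qed.

Lemma measurable_offspring (s : nat) (v : (q s).-tuple 'I_(q s.+1).+1) :
  (0 < s)%N -> measurable (offspring s @^-1` [set v]).
Proof.
move=> s0; rewrite preimage_offspring// -[X in measurable X]setTI.
by apply: measurable_funP => //; exact: measurable_tuple_nat1.
Qed.

(* The vertices of height [s] with a descendant at height [s + k], numbered
   from left to right. *)
Fixpoint ancestors (k s : nat) (w : T) : {set 'I_(q s)} :=
  if k is k'.+1 then parents (cm_nu M s w) (ancestors k' s.+1 w)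
  else [set: 'I_(q s)]%SET.

Definition ancestors_law (k s : nat) (S : {set 'I_(q s)}) : R :=
  pr P (ancestors k s @^-1` [set S]).

Definition offspring_law (s : nat) (v : (q s).-tuple 'I_(q s.+1).+1) : R :=
  pr P (offspring s @^-1` [set v]).

Definition step (k s : nat) (w : T) := (offspring s w, ancestors k s.+1 w).

Lemma preimage_step (k s : nat) x : step k s @^-1` [set x] =
  offspring s @^-1` [set x.1] `&` ancestors k s.+1 @^-1` [set x.2].
Proof. by case: x => v S; apply/seteqP; split => w /= [<- <-]. Qed.

Lemma preimage_ancestorsS (k s : nat) (S : {set 'I_(q s)}) : (0 < s)%N ->
  ancestors k.+1 s @^-1` [set S] =
  step k s @^-1` [set x | parents (numbers x.1) x.2 = S].
Proof.
by move=> s0; apply/seteqP; split => w; rewrite /preimage/= numbers_offspring.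
Qed.

Lemma measurable_ancestors (k s : nat) (S : {set 'I_(q s)}) : (0 < s)%N ->
  measurable (ancestors k s @^-1` [set S]).
Proof.
elim: k s S => [|k IH] s S s0.
  have [->|ST] := eqVneq S [set: 'I_(q s)]%SET.
    by rewrite (_ : _ @^-1` _ = setT)//; apply/seteqP; split.
  rewrite (_ : _ @^-1` _ = set0)//; apply/seteqP; split => // w /= /esym/eqP.
  by rewrite (negbTE ST).
rewrite preimage_ancestorsS//; apply: measurable_preimage_fin => -[v S'].
by rewrite preimage_step; apply: measurableI; [exact: measurable_offspring|exact: IH].
Qed.

Lemma measurable_step (k s : nat) x : (0 < s)%N ->
  measurable (step k s @^-1` [set x]).
Proof.
move=> s0; rewrite preimage_step; apply: measurableI.
  exact: measurable_offspring.
exact: measurable_ancestors.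
Qed.

Lemma pr_ancestorsS (k s : nat) (S : {set 'I_(q s)}) (B : set T) :
  (0 < s)%N -> measurable B ->
  pr P (B `&` ancestors k.+1 s @^-1` [set S]) =
  \sum_x (parents (numbers x.1) x.2 == S)%:R * pr P (B `&` step k s @^-1` [set x]).
Proof.
move=> s0 mB; rewrite (pr_partition P (fun x => measurable_step k x s0)); last first.
    by apply: measurableI => //; exact: measurable_ancestors.
  apply: eq_bigr => x _; rewrite preimage_ancestorsS//.
  have [xS|xS] := eqVneq; rewrite ?mul1r ?mul0r.
    congr pr; apply/seteqP; split => w; first by case=> -[].
    by case=> Bw wx; move: xS; rewrite -(wx : step k s w = x).
  rewrite (_ : _ `&` _ = set0) ?/pr ?measure0//.
  apply/seteqP; split => // w /= [[_ wS] wx]; move/eqP: xS; apply.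
  by rewrite -(wx : step k s w = x).
Qed.

Definition cylinder (J : seq nat) (A : forall j, set ((q j).-tuple nat)) : set T :=
  \bigcap_(j in [set` J]) (cm_nu M j @^-1` A j).

(** The set depends only on generations from [s] on. The cylinder over earlier generations is kept
    arbitrary so that the induction on [k] can move generation [s] into it and continue from
    [s.+1]. *)
Lemma ancestors_independent (k s : nat) (S : {set 'I_(q s)}) (J : seq nat)
    (A : forall j, set ((q j).-tuple nat)) :
  (0 < s)%N -> uniq J -> (forall j, j \in J -> (0 < j < s)%N) ->
  (forall j, j \in J -> measurable (A j)) ->
  pr P (cylinder J A `&` ancestors k s @^-1` [set S]) =
  (\prod_(j <- J) pr P (cm_nu M j @^-1` A j)) * ancestors_law k S.
Proof.
have mnu j B : measurable B -> measurable (cm_nu M j @^-1` B).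
  by move=> mB; rewrite -[X in measurable X]setTI; exact: measurable_funP.
have mcyl J' A' : (forall j, j \in J' -> measurable (A' j)) ->
    measurable (cylinder J' A').
  move=> mA; apply: fin_bigcap_measurable => [|j jJ]; first exact: finite_seq.
  by apply: mnu; exact: mA.
elim: k s S J A => [|k IH] s S J A s0 uJ Js mA; rewrite /ancestors_law.
  have [->|ST] := eqVneq S [set: 'I_(q s)]%SET; last first.
    have -> : ancestors 0 s @^-1` [set S] = set0.
      apply/seteqP; split => // w /= /esym/eqP; by rewrite (negbTE ST).
    by rewrite setI0 /pr measure0 mulr0.
  have -> : ancestors 0 s @^-1` [set [set: 'I_(q s)]%SET] = setT.
    by apply/seteqP; split.
  rewrite setIT /pr probability_setT mulr1.
  have -> : P (cylinder J A) =
      (\big[*%E/1]_(j <- J) P (cm_nu M j @^-1` A j))%E.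
    by apply: (cm_independent uJ) => // j /= /Js /andP[].
  rewrite (eq_big_seq (fun j => (pr P (cm_nu M j @^-1` A j))%:E)) ?prodEFin//.
  by move=> j jJ; apply: pr_EFin; apply: mnu; exact: mA.
rewrite pr_ancestorsS//; last exact: mcyl.
rewrite -[X in _ = _ * pr P X]setTI pr_ancestorsS// mulr_sumr.
apply: eq_bigr => -[v S'] _; rewrite mulrCA; congr (_ * _).
rewrite setTI preimage_step /= preimage_offspring//.
have key J' A' : uniq J' -> (forall j, j \in J' -> (0 < j < s)%N) ->
    (forall j, j \in J' -> measurable (A' j)) ->
    pr P (cylinder J' A' `&` (cm_nu M s @^-1` [set numbers v] `&`
      ancestors k s.+1 @^-1` [set S'])) =
    (\prod_(j <- J') pr P (cm_nu M j @^-1` A' j)) *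
    (pr P (cm_nu M s @^-1` [set numbers v]) * ancestors_law k S').
  (* [A2] is [A'] with the constraint on generation [s] added. *)
  move=> uJ' J's mA'; pose A2 : forall j, set ((q j).-tuple nat) := eqtype.dfwith A' [set numbers v].
  have A2E j : j \in J' -> A2 j = A' j.
    move=> jJ; rewrite /A2 eqtype.dfwith_out//; have := J's _ jJ; lia.
  have sJ : s \notin J' by apply/negP => /J's; rewrite ltnn andbF.
  have cyl : cylinder (s :: J') A2 =
      cm_nu M s @^-1` [set numbers v] `&` cylinder J' A'.
    rewrite /cylinder !bigcap_seq big_cons {1}/A2 eqtype.dfwith_in.
    by congr (_ `&` _); apply: eq_big_seq => j jJ; rewrite A2E.
  rewrite setIA [X in X `&` _]setIC -cyl IH//= ?sJ//.
  - rewrite big_cons {1}/A2 eqtype.dfwith_in mulrA; congr (_ * _).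
    rewrite mulrC; congr (_ * _).
    by apply: eq_big_seq => j jJ; rewrite A2E.
  - by move=> j; rewrite inE => /predU1P[->|/J's]; lia.
  - move=> j; rewrite inE => /predU1P[->|jJ].
      by rewrite /A2 eqtype.dfwith_in; exact: measurable_tuple_nat1.
    by rewrite A2E//; exact: mA'.
rewrite key//; congr (_ * _).
(* With the empty cylinder, [key] factors the law of the single step. *)
have := key [::] A isT; rewrite big_nil mul1r => <-//.
by congr pr; rewrite /cylinder classical_sets.set_nil bigcap_set0 setTI.
Qed.

Lemma pr_step (k s : nat) x : (0 < s)%N ->
  pr P (step k s @^-1` [set x]) = offspring_law x.1 * ancestors_law k x.2.
Proof.
case: x => v S s0; rewrite preimage_step /=.
pose A : forall j, set ((q j).-tuple nat) :=
  eqtype.dfwith (fun=> setT) [set numbers v].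
have := @ancestors_independent k s.+1 S [:: s] A isT isT.
rewrite big_seq1 /cylinder bigcap_seq big_seq1 /A eqtype.dfwith_in.
rewrite -preimage_offspring//; apply.
  by move=> j; rewrite inE => /eqP ->; rewrite s0 ltnSn.
move=> j; rewrite inE => /eqP ->; rewrite eqtype.dfwith_in.
exact: measurable_tuple_nat1.
Qed.

Lemma ancestors_lawS (k s : nat) (S : {set 'I_(q s)}) : (0 < s)%N ->
  ancestors_law k.+1 S =
  parents_law (@offspring_law s) (ancestors_law k (s := s.+1)) S.
Proof.
move=> s0; rewrite /ancestors_law -[X in pr P X]setTI pr_ancestorsS//.
rewrite /parents_law pair_bigA /=; apply: eq_bigr => x _.
by rewrite setTI pr_step// mulrC.
Qed.

Lemma offspring_law_ge0 (s : nat) v : 0 <= @offspring_law s v.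
Proof. exact: pr_ge0. Qed.

Lemma ancestors_law_ge0 (k s : nat) S : 0 <= @ancestors_law k s S.
Proof. exact: pr_ge0. Qed.

Lemma offspring_law_sum1 (s : nat) : (0 < s)%N -> \sum_v @offspring_law s v = 1.
Proof.
move=> s0; have := pr_partition P (fun v => measurable_offspring v s0) measurableT.
rewrite {1}/pr probability_setT => /= ->.
by apply: eq_bigr => v _; rewrite setTI.
Qed.

Lemma ancestors_law_sum1 (k s : nat) : (0 < s)%N ->
  \sum_S @ancestors_law k s S = 1.
Proof.
move=> s0.
have := pr_partition P (fun S => @measurable_ancestors k s S s0) measurableT.
rewrite {1}/pr probability_setT => /= ->.
by apply: eq_bigr => v _; rewrite setTI.
Qed.

Lemma offspring_law_sum (s : nat) v : (0 < s)%N -> @offspring_law s v != 0 ->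
  (\sum_(i < q s) tnth (numbers v) i)%N = q s.+1.
Proof.
move=> s0; have [[w wv] _|nv] := pselect (exists w, offspring s w = v).
  by rewrite -wv numbers_offspring// cm_sum.
rewrite /offspring_law (_ : _ @^-1` _ = set0) ?/pr ?measure0 ?eqxx//.
by apply/seteqP; split => // w wv; apply: nv; exists w.
Qed.

Lemma offspring_law_permute (s : nat) p v : (0 < s)%N ->
  @offspring_law s (permute p v) = offspring_law v.
Proof.
move=> s0; rewrite /offspring_law !preimage_offspring// /pr.
have := cm_exchangeable (p^-1)%g s0 (measurable_tuple_nat1 (numbers v)).
rewrite -/(preimage (cm_nu M s) [set numbers v]) => <-; congr (fine (P _)).
apply/seteqP; split => w /=; rewrite permute_numbers.
  move=> ->; apply: eq_from_tnth => i; by rewrite !tnth_mktuple permKV.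
move=> <-; apply: eq_from_tnth => i; by rewrite !tnth_mktuple permK.
Qed.

Lemma ancestors_law_card_invariant (k s : nat) : (0 < s)%N ->
  card_invariant (@ancestors_law k s).
Proof.
elim: k s => [|k IH] s s0 S S' SS'.
  (* For [k = 0] the set is the whole generation, and two sets of equal cardinal are both whole or
     both not. *)
  rewrite /ancestors_law; congr pr; apply/seteqP.
  by split => w /= E; apply/esym/eqP; rewrite eqEcard finset.subsetT E ?SS' -?SS' /=.
rewrite !ancestors_lawS//; apply: parents_law_card_invariant SS'.
- by move=> v; exact: offspring_law_sum.
- by move=> p v; exact: offspring_law_permute.
- exact: IH.
Qed.

Definition mean_ancestors (k s : nat) : R :=
  \sum_S @ancestors_law k s S * #|S|%:R.

Lemma mean_ancestors0 (s : nat) : (0 < s)%N -> mean_ancestors 0 s <= (q s)%:R.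
Proof.
move=> s0.
have -> : (q s)%:R = \sum_S @ancestors_law 0 s S * (q s)%:R :> R.
  by rewrite -mulr_suml (ancestors_law_sum1 0 s0) mul1r.
apply: ler_sum => S _; rewrite ler_wpM2l ?ancestors_law_ge0//.
by rewrite ler_nat -[leqRHS]card_ord max_card.
Qed.

Lemma mean_ancestors_step (k s : nat) (L V c t : R) :
  (0 < s)%N -> (0 < q s)%N -> (2 < q s.+1)%N ->
  0 <= t <= L / 2 -> L * V <= (q s.+1)%:R -> 0 <= c ->
  (c%:E <= expectation P (fun w =>
     (nu1 s w ^_ 2)%:R * (if (nu1 s w)%:R <= V then 1 else 0))%R)%E ->
  mean_ancestors k.+1 s <= mean_ancestors k s.+1 -
    c * (q s)%:R / (4 * (q s.+1)%:R ^+ 2) *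
    (2 * t * (mean_ancestors k s.+1 - 1) - t ^+ 2).
Proof.
move=> s0 qs0 Q2 tL LV c0 cE.
rewrite {1}/mean_ancestors; under eq_bigr do rewrite ancestors_lawS//.
apply: (@mean_parents_law_le R _ _ _ _ _ _ _ _ _ _ _ (Ordinal qs0) L V) => //.
- exact: offspring_law_ge0.
- by move=> v; exact: offspring_law_sum.
- exact: offspring_law_sum1.
- by move=> p v; exact: offspring_law_permute.
- exact: ancestors_law_ge0.
- exact: ancestors_law_sum1.
- exact: ancestors_law_card_invariant.
pose f (v : (q s).-tuple 'I_(q s.+1).+1) : R :=
  (tnth (numbers v) (Ordinal qs0) ^_ 2)%:R *
  ((tnth (numbers v) (Ordinal qs0))%:R <= V)%R%:R.
rewrite -lee_fin; apply: (le_trans cE).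
have := expectation_fin P (fun v => @measurable_offspring s v s0) (f := f).
move=> E; rewrite -E; last by move=> v; rewrite mulr_ge0.
rewrite le_eqVlt; apply/orP; left; apply/eqP; congr (expectation P _).
apply/funext => w /=; rewrite /f numbers_offspring// /nu1 (tnth_nth 0%N).
by case: ifP => //= _; case: (_ <= _).
Qed.

(** Markov's inequality, on the finite partition by the value of the set. *)
Lemma pr_ancestors_gt (k s : nat) (x : R) : (0 < s)%N -> 0 < x ->
  (P [set w | x < #|ancestors k s w|%:R]%R <= (mean_ancestors k s / x)%:E)%E.
Proof.
move=> s0 x0; have mS S := @measurable_ancestors k s S s0.
set E := [set w | _].
have mE : measurable E := measurable_preimage_fin mS [set S : {set 'I_(q s)} | x < #|S|%:R].
rewrite pr_EFin// lee_fin (pr_partition P mS mE) mulr_suml.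
apply: ler_sum => S _; have [xS|xS] := ltP x #|S|%:R.
  rewrite -mulrA -[leLHS]mulr1 ler_pM ?pr_ge0 ?ler_pdivlMr ?mul1r ?(ltW xS)//.
  rewrite /ancestors_law /pr fine_le ?fin_num_measure ?le_measure ?inE//;
    exact: measurableI.
rewrite (_ : _ `&` _ = set0) ?/pr ?measure0.
  by rewrite divr_ge0 ?mulr_ge0 ?ancestors_law_ge0// ltW.
apply/seteqP; split => // w [/= xw wS].
by have := xw : x < #|ancestors k s w|%:R; rewrite (wS : ancestors k s w = S) ltNge xS.
Qed.

End model.

(** * The tree *)

Definition next_level (l : seq (seq nat)) (c : seq nat) : seq (seq nat) :=
  flatten [seq [seq rcons u.1 j | j <- iota 0 u.2] | u <- zip l c].

Lemma shape_next_level (l : seq (seq nat)) (c : seq nat) : size l = size c ->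
  shape [seq [seq rcons u.1 j | j <- iota 0 u.2] | u <- zip l c] = c.
Proof.
move=> lc; rewrite /shape -map_comp -[RHS](unzip2_zip (s := l)) ?lc//.
by apply: eq_map => -[u x] /=; rewrite size_map size_iota.
Qed.

Lemma size_next_level (l : seq (seq nat)) (c : seq nat) : size l = size c ->
  size (next_level l c) = sumn c.
Proof. by move=> lc; rewrite size_flatten shape_next_level. Qed.

(** This identifies the numbering by [reshape_index], used for [parent], with the lexicographic
    order of the words. *)
Lemma nth_next_level (l : seq (seq nat)) (c : seq nat) (j : nat) :
  size l = size c -> (j < sumn c)%N ->
  nth [::] (next_level l c) j =
  rcons (nth [::] l (reshape_index c j)) (reshape_offset c j).
Proof.
move=> lc jc; rewrite nth_flatten shape_next_level//.
have rc := reshape_indexP jc.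
rewrite (nth_map ([::], 0%N)) ?size_zip ?lc ?minnn// nth_zip//=.
by rewrite (nth_map 0%N) ?size_iota ?reshape_offsetP// nth_iota ?reshape_offsetP.
Qed.

Lemma mem_next_level (l : seq (seq nat)) (c : seq nat) (v : seq nat) :
  v \in next_level l c -> exists2 u, u \in l & exists x, v = rcons u x.
Proof.
elim: l c => [|u l IH] [|x c]//; rewrite /next_level /= mem_cat.
case/orP=> [/mapP[j _ ->]|/IH[u' u'l vE]].
  by exists u; [exact: mem_head|exists j].
by exists u' => //; rewrite inE u'l orbT.
Qed.

Lemma uniq_next_level (l : seq (seq nat)) (c : seq nat) :
  uniq l -> uniq (next_level l c).
Proof.
elim: l c => [|u l IH] [|x c]//= /andP[ul uql].
rewrite /next_level /= cat_uniq -/(next_level l c) IH// andbT.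
rewrite map_inj_uniq ?iota_uniq /=; last by move=> i j /rcons_inj[].
apply/hasPn => v /mem_next_level[u' u'l [y ->]]; apply/mapP => -[j _].
by move=> /rcons_inj[uu' _]; rewrite -uu' u'l in ul.
Qed.

Section model.
Variables (R : realType) (M : cannings_model R).
Notation q := (cm_q M).

Lemma level1 (w : cm_space M) : level 1 w = [seq [:: j] | j <- iota 0 (q 1)].
Proof. by rewrite /= cats0; exact: eq_map. Qed.

Lemma levelS (k : nat) (w : cm_space M) :
  level k.+2 w = next_level (level k.+1 w) (cm_nu M k.+1 w).
Proof. by []. Qed.

Lemma sumn_nu (k : nat) (w : cm_space M) : (0 < k)%N ->
  sumn (cm_nu M k w) = q k.+1.
Proof. by move=> k0; rewrite sumn_tuple cm_sum. Qed.

Lemma size_level (k : nat) (w : cm_space M) : (0 < k)%N ->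
  size (level k w) = q k.
Proof.
case: k => // -[_|k _]; first by rewrite level1 size_map size_iota.
elim: k => [|k IH].
  by rewrite levelS size_next_level ?sumn_nu// level1 size_map size_iota size_tuple.
by rewrite levelS size_next_level ?sumn_nu// IH size_tuple.
Qed.

Lemma uniq_level (k : nat) (w : cm_space M) : uniq (level k w).
Proof. by elim: k => //= k IH; exact: uniq_next_level. Qed.

Lemma mem_levelS (k : nat) (v : seq nat) (w : cm_space M) :
  v \in level k.+1 w -> exists2 u, u \in level k w & exists x, v = rcons u x.
Proof. exact: mem_next_level. Qed.

Lemma size_word (k : nat) (v : seq nat) (w : cm_space M) :
  v \in level k w -> size v = k.
Proof.
elim: k v => [|k IH] v; first by rewrite inE => /eqP ->.
by move=> /mem_levelS[u uk [x ->]]; rewrite size_rcons (IH _ uk).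
Qed.

Lemma take_level (a k : nat) (v : seq nat) (w : cm_space M) :
  v \in level (a + k) w -> take a v \in level a w.
Proof.
elim: k v => [|k IH] v.
  by rewrite addn0 => va; rewrite take_oversize ?(size_word va).
rewrite addnS => /mem_levelS[u uk [x ->]].
by rewrite -cats1 takel_cat ?IH// (size_word uk) leq_addr.
Qed.

(** By induction on [k], through the child of [i] on the ancestral line of [v], which is the prefix
    of [v] of length [a.+1]. *)
Lemma mem_ancestors (k a : nat) (w : cm_space M) (i : 'I_(q a)) : (0 < a)%N ->
  (i \in ancestors k a w) =
  has (fun v => prefix (nth [::] (level a w) i) v) (level (a + k) w).
Proof.
elim: k a i => [|k IH] a i a0.
  rewrite inE addn0; apply/esym/hasP; exists (nth [::] (level a w) i) => //.
    by rewrite mem_nth// size_level.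
  exact: prefix_refl.
have sz : size (level a w) = size (cm_nu M a w) by rewrite size_level ?size_tuple.
have lS : level a.+1 w = next_level (level a w) (cm_nu M a w).
  by case: (a) a0.
rewrite addnS -addSn [ancestors _ _ _]/= inE; apply/existsP/hasP => [[j /andP[]]|[v va iv]].
  rewrite IH// parent_eqE => /hasP[v vl jv] /eqP ji; exists v => //.
  apply: prefix_trans jv; rewrite lS nth_next_level ?sumn_nu//.
  by rewrite ji prefix_rcons.
have ta := take_level va.
have jq : (index (take a.+1 v) (level a.+1 w) < q a.+1)%N.
  by rewrite -(size_level w (ltn0Sn a)) index_mem.
exists (Ordinal jq); rewrite IH// parent_eqE /= nth_index//.
apply/andP; split; first by apply/hasP; exists v => //; exact: prefix_take.
(* Dropping the last letter of that prefix gives both the word of its parent [r] and that of [i];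
   words of one level are distinct, so [r = i]. *)
have := nth_index [::] ta; rewrite {1}lS nth_next_level ?sumn_nu//.
set r := reshape_index _ _; move=> /(congr1 (take a)).
have rq : (r < q a)%N.
  by have := @reshape_indexP (cm_nu M a w) _; rewrite sumn_nu// size_tuple; apply.
have sa m : (m < q a)%N -> size (nth [::] (level a w) m) = a.
  by move=> mq; apply: (@size_word _ _ w); rewrite mem_nth// size_level.
rewrite -cats1 take_cat sa// ltnn subnn take0 cats0 take_takel//.
move: iv; rewrite prefixE sa// => /eqP -> /eqP.
by rewrite nth_uniq ?size_level ?uniq_level.
Qed.

Lemma nb_with_descendantE (a k : nat) (w : cm_space M) : (0 < a)%N ->
  nb_with_descendant a (a + k) w = #|ancestors k a w|.
Proof.
move=> a0; rewrite /nb_with_descendant.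
rewrite -{1}(mkseq_nth [::] (level a w)) size_level// /mkseq count_map.
rewrite cardE size_filter -val_enum_ord count_map /enum_mem filter_predT.
by apply: eq_count => i /=; rewrite mem_ancestors.
Qed.

End model.

(** * Asymptotics *)

(* Above the level [L / 2] the recursion contracts geometrically; below it, it
   is [y' <= y - kappa * y ^+ 2], so that [1 / y] grows by [kappa] per step. *)
Lemma recursion_bound (R : realType) (kappa L B : R) (y : nat -> R) (N T : nat) :
  0 < kappa -> 0 <= L -> 0 <= B ->
  (forall i t, (i < T)%N -> 0 <= t <= L / 2 ->
     y i.+1 <= y i - kappa * (2 * t * y i - t ^+ 2)) ->
  y 0%N <= B -> B * expR (- (kappa * L / 2 * N%:R)) <= L / 2 ->
  (0 < N)%N -> (N.*2 <= T)%N -> y T <= (kappa * N%:R)^-1.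
Proof.
move=> k0 L0 B0 yP y0 BN N0 NT.
have L2 : 0 <= L / 2 by rewrite divr_ge0.
have dec i : (i < T)%N -> y i.+1 <= y i.
  by move=> iT; have := yP i 0 iT; rewrite lexx L2 => /(_ isT); lra.
(* While [y i > L / 2], the choice [t := L / 2] multiplies [y i] by at most [1 - kappa * L / 2],
   which is at most the exponential factor. *)
have phase1 i : (i <= T)%N ->
    y i <= Num.max (L / 2) (B * expR (- (kappa * L / 2 * i%:R))).
  elim: i => [_|i IH iT]; first by rewrite mulr0 oppr0 expR0 mulr1 le_max y0 orbT.
  have {IH} := IH (ltnW iT); rewrite !le_max => yi.
  have [yL|yL] := leP (y i) (L / 2); first by rewrite (le_trans (dec _ iT) yL).
  move: yi; rewrite leNgt yL /= => yi; apply/orP; right.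
  rewrite -[i.+1%:R]natr1 [_ * (_ + 1)]mulrDr mulr1 opprD expRD mulrA.
  apply: le_trans (ler_wpM2r (expR_ge0 _) yi).
  apply: (@le_trans _ _ (y i * (1 - kappa * L / 2))).
    apply: le_trans (yP i (L / 2) iT _) _; first by rewrite L2 lexx.
    have : 0 <= kappa * L / 2 * (y i - L / 2).
      by rewrite !mulr_ge0 ?invr_ge0 ?subr_ge0// ltW.
    by lra.
  by rewrite ler_wpM2l ?expR_ge1Dx// (le_trans L2)// ltW.
(* From here [t := y] is admissible when positive. Starting at index [N.+1], the first bound needs
   only [x - x ^+ 2 <= 1] for [x := kappa * y N]. *)
have phase2 j : (N + j.+1 <= T)%N ->
    y (N + j.+1)%N <= L / 2 /\ y (N + j.+1)%N <= (kappa * j.+1%:R)^-1.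
  elim: j => [|j IH] jT.
    have NT' : (N < T)%N by lia.
    have yN : y N <= L / 2.
      have := phase1 N (ltnW NT'); rewrite le_max => /orP[//|]; move/le_trans; exact.
    rewrite addn1 mulr1; split; first exact: le_trans (dec _ NT') yN.
    have [yN0|yN0] := leP (y N) 0.
      by rewrite (le_trans (dec _ NT'))// (le_trans yN0)// invr_ge0 ltW.
    apply: le_trans (yP _ (y N) NT' _) _; first by rewrite ltW.
    rewrite -[leRHS]mul1r ler_pdivlMr//; have := sqr_ge0 (kappa * y N - 1); nra.
  have NT' : (N + j.+1 < T)%N by lia.
  have [yL yj] := IH (ltnW NT'); rewrite [in y _]addnS.
  split; first exact: le_trans (dec _ NT') yL.
  have {1}-> : j.+2%:R = j.+1%:R + 1 :> R by rewrite natr1.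
  have j0 : 1 <= j.+1%:R :> R by rewrite ler1n.
  move: yj (yP _ (y (N + j.+1)%N) NT') (dec _ NT') yL.
  set z := y (N + j.+1)%N; set z' := y _; set x := j.+1%:R => zx yz z'z zL.
  have xk : 0 < kappa * x by rewrite mulr_gt0//; lra.
  have xk1 : 0 < kappa * (x + 1) by rewrite mulr_gt0//; lra.
  move: zx; rewrite -[leRHS]mul1r ler_pdivlMr// => zx.
  rewrite -[leRHS]mul1r ler_pdivlMr//.
  (* If [z] is already below the next bound, monotonicity suffices; otherwise [z] is positive and
     [t := z] is allowed. *)
  have [zx1|zx1] := leP (z * (kappa * (x + 1))) 1.
    by apply: le_trans zx1; rewrite ler_wpM2r// ltW.
  have z0 : 0 < z by rewrite -(pmulr_lgt0 _ xk1); apply: lt_trans zx1.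
  have {}yz : z' <= z - kappa * z ^+ 2.
    by apply: le_trans (yz _) _; [rewrite ltW|lra].
  apply: le_trans (ler_wpM2r (ltW xk1) yz) _.
  (* [(1 - kappa z)(kappa z (x + 1)) <= 1] since [x <= 1 / (kappa z) < x + 1] *)
  have -> : (z - kappa * z ^+ 2) * (kappa * (x + 1)) =
    z * (kappa * (x + 1)) - kappa * z * (z * (kappa * (x + 1))) by ring.
  have kz0 : 0 < kappa * z by rewrite mulr_gt0.
  have : kappa * z <= kappa * z * (z * (kappa * (x + 1))) by nra.
  have -> : z * (kappa * (x + 1)) = z * (kappa * x) + kappa * z by ring.
  by lra.
have mono j : (N + N <= j)%N -> (j <= T)%N -> y j <= y (N + N)%N.
  elim: j => [|j IH]; first by case: (N) N0.
  rewrite leq_eqVlt => /predU1P[-> //|Nj jT].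
  by rewrite (le_trans (dec _ jT))// IH// ltnW.
apply: le_trans (mono T _ _) _ => //; first by rewrite addnn.
(* The second phase is used at [j := N - 1], that is at index [N + N]. *)
by case: N N0 NT phase2 {BN mono} => // N _ NT /(_ N) []; rewrite // addnn.
Qed.

Lemma subnS_bounds (a b i : nat) : (i < b - a)%N ->
  (b - i = (b - i.+1).+1)%N /\ (a <= b - i.+1 < b)%N.
Proof. by lia. Qed.

(** The recursion runs downwards from height [b], with time [i] at height [b - i]; [kappa] is a
    lower bound, uniform in the height, for the coefficient of [mean_ancestors_step]. *)
Lemma mean_ancestors_le (R : realType) (M : cannings_model R) (a b N : nat)
    (L V c q1 q2 : R) (kappa := c * q1 / (4 * q2 ^+ 2)) :
  (0 < a)%N -> (0 < N)%N -> (N.*2 <= b - a)%N -> 0 < c -> 2 < q1 ->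
  (forall s, (a <= s <= b)%N -> q1 <= (cm_q M s)%:R <= q2) ->
  (forall s, (a <= s < b)%N -> (c%:E <= expectation (cm_P M) (fun w =>
     (nu1 s w ^_ 2)%:R * (if (nu1 s w)%:R <= V then 1 else 0))%R)%E) ->
  0 <= L -> L * V <= q1 -> q2 * expR (- (kappa * L / 2 * N%:R)) <= L / 2 ->
  mean_ancestors M (b - a) a <= 1 + (kappa * N%:R)^-1.
Proof.
move=> a0 N0 Nba c0 q12 qP cP L0 LV q2N.
have ab : (a <= b)%N.
  by rewrite ltnW// -subn_gt0 (leq_trans _ Nba)// double_gt0.
have q02 : 2 < q2.
  by have /andP[h1 h2] := qP a (introT andP (conj (leqnn a) ab)); lra.
have k0 : 0 < kappa.
  by rewrite /kappa divr_gt0 ?mulr_gt0 ?exprn_gt0//; lra.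
pose y i := mean_ancestors M i (b - i) - 1.
have := @recursion_bound R kappa L q2 y N (b - a) k0 L0.
rewrite /y subKn// -lerBlDl; apply=> //; first lra; last first.
  have /andP[_ qb] := qP b (introT andP (conj ab (leqnn b))).
  by rewrite subn0; have := @mean_ancestors0 R M b (leq_trans a0 ab); lra.
move=> i t iT tL; pose s := (b - i.+1)%N.
have [sE /andP[sa sb]] := subnS_bounds iT; rewrite -/s in sE sa sb.
have /andP[qs1 qs2] := qP s (introT andP (conj sa (ltnW sb))).
have /andP[Qs1 Qs2] := qP s.+1 (introT andP (conj (leqW sa) sb)).
have main t' : 0 <= t' <= L / 2 -> mean_ancestors M i.+1 s <=
    mean_ancestors M i s.+1 - c * (cm_q M s)%:R / (4 * (cm_q M s.+1)%:R ^+ 2) *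
    (2 * t' * (mean_ancestors M i s.+1 - 1) - t' ^+ 2).
  move=> t'L; apply: (@mean_ancestors_step R M i s L V c t') => //.
  - exact: leq_trans a0 sa.
  - by rewrite -(ltr0n R); lra.
  - by rewrite -(ltr_nat R); lra.
  - by lra.
  - exact: ltW.
  - by apply: cP; rewrite sa.
rewrite -/s sE.
set X := 2 * t * (mean_ancestors M i s.+1 - 1) - t ^+ 2.
(* Replacing the coefficient by [kappa] is legitimate only for [X > 0]; otherwise the monotonicity
   given by [t' := 0] is stronger than the claim. *)
have [X0|X0] := leP X 0.
  have := main 0 _; rewrite lexx divr_ge0// => /(_ isT).
  have : 0 <= kappa * - X by rewrite mulr_ge0 ?oppr_ge0// ltW.
  by lra.
have : kappa * X <= c * (cm_q M s)%:R / (4 * (cm_q M s.+1)%:R ^+ 2) * X.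
  rewrite ler_wpM2r ?(ltW X0)// /kappa ler_pM//.
  - by rewrite mulr_ge0//; lra.
  - by rewrite invr_ge0 mulr_ge0// sqr_ge0.
  - by rewrite ler_wpM2l// ltW.
  - by rewrite lef_pV2 ?posrE ?mulr_gt0 ?exprn_gt0 ?ler_pM2l ?lerXn2r ?nnegrE//; lra.
by have := main t tL; rewrite -/X; lra.
Qed.

(** * Limits superior and inferior, and powers of the logarithm *)

Section limits.
Variable R : realType.

Lemma limn_esup_le_near (u : nat -> \bar R) (x : \bar R) :
  (\forall n \near \oo, (u n <= x)%E) -> (limn_esup u <= x)%E.
Proof.
move=> ux; apply: (@le_trans _ _ (ereal_sup (u @` [set n | (u n <= x)%E]))).
  by apply: ereal_inf_lbound; exists [set n | (u n <= x)%E].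
by apply: ge_ereal_sup => _ [n nx <-].
Qed.

Lemma limn_einf_gt0_near (u : nat -> \bar R) : (0 < limn_einf u)%E ->
  exists2 c : R, 0 < c & \forall n \near \oo, (c%:E <= u n)%E.
Proof.
rewrite /limn_einf -/(limf_einf u \oo) limf_einfE => /ereal_sup_gt[_ [V VF <-]].
move=> inf0; have [c [c0 cV]] : exists c : R, 0 < c /\ (c%:E <= ereal_inf (u @` V))%E.
  move: inf0; case: (ereal_inf _) => [x| |]//; last by exists 1; rewrite leey.
  by rewrite lte_fin => x0; exists x.
exists c => //; apply: filterS VF => n Vn; apply: le_trans cV _.
by apply: ereal_inf_lbound; exists n.
Qed.

Lemma near_ln_ge (A : R) : \forall n \near \oo, A <= ln (n%:R : R).
Proof.
near=> n; have n0 : 0 < n%:R :> R by rewrite ltr0n; near: n; exact: nbhs_infty_gt.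
rewrite -(expRK A) ler_ln ?posrE ?expR_gt0//.
by near: n; exact: nbhs_infty_ger.
Unshelve. all: by end_near. Qed.

Lemma near_ln_powR_ge (A e : R) : 0 < e ->
  \forall n \near \oo, A <= (ln (n%:R : R)) `^ e.
Proof.
move=> e0; near=> n.
pose B := Num.max 1 A.
have B0 : 0 <= B by rewrite le_max ler01.
have lnB : B `^ e^-1 <= ln (n%:R : R) by near: n; exact: near_ln_ge.
apply: (@le_trans _ _ B); first by rewrite le_max lexx orbT.
have -> : B = (B `^ e^-1) `^ e.
  by rewrite -powRrM mulVf ?gt_eqF// powRr1.
rewrite ge0_ler_powR ?nnegrE ?powR_ge0//; first exact: ltW.
by apply: le_trans lnB; rewrite powR_ge0.
Unshelve. all: by end_near. Qed.

End limits.

(** The extrema on the segment are attained, and a zero minimum would put a positive zero of [f]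
    before [hprof f]. *)
Lemma continuous_profile_bounds (R : realType) (f : R -> R) (lo hi : R) :
  continuous_profile f -> 0 < lo -> lo <= hi -> (hi%:E < hprof f)%E ->
  exists m0 m1 : R, 0 < m0 /\ forall x, lo <= x <= hi -> m0 <= f x <= m1.
Proof.
move=> [f0 _ fc _] lo0 lohi hih.
have sub : [set` `[lo, hi]] `<=` [set x : R | 0 <= x /\ (x%:E < hprof f)%E].
  move=> x /=; rewrite in_itv /= => /andP[lx xh]; split; first lra.
  by apply: le_lt_trans hih; rewrite lee_fin.
have fc' := continuous_subspaceW sub fc.
have [c0 c0P fmin] := EVT_min lohi fc'; have [c1 c1P fmax] := EVT_max lohi fc'.
exists (f c0), (f c1); split; last first.
  by move=> x xP; rewrite fmin ?fmax// in_itv.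
have [c00 c0h] := sub _ c0P; rewrite lt_neqAle f0// andbT eq_sym.
apply/eqP => fc0; move: c0h; rewrite ltNge => /negP; apply.
apply: ereal_inf_lbound; exists c0 => //; split => //.
by move: c0P; rewrite in_itv /= => /andP[]; lra.
Qed.

Lemma truncn_mul_div (R : realType) (n s : nat) : (0 < n)%N ->
  Num.truncn (n%:R * (s%:R / n%:R) : R) = s.
Proof. by move=> n0; rewrite mulrCA mulfV ?pnatr_eq0 ?lt0n_neq0// mulr1 natrK. Qed.

(** * Uniform control of the rescaled models *)

Section scaling.
Variables (R : realType) (C : nat -> cannings_model R) (ell sigma : R -> R).

Lemma near_profile_bounds (lo hi : R) : H1 C ell sigma ->
  0 < lo -> lo <= hi -> (hi%:E < hprof ell)%E ->
  exists q1 q2 : R, [/\ 0 < q1, q1 <= q2 & \forall n \near \oo, forall s : nat,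
    lo * n%:R <= s%:R <= hi * n%:R ->
    q1 * n%:R <= (cm_q (C n) s)%:R <= q2 * n%:R].
Proof.
move=> [[ellP _ _ _] [[_ unif _] _ _]] lo0 lohi hih.
have [m0 [m1 [m00 mP]]] := continuous_profile_bounds ellP lo0 lohi hih.
(* Half the lower bound of [ell] serves as the uniform error, evaluated at [x := s / n]. *)
exists (m0 / 2), (m1 + m0 / 2); split; [lra| |].
  by have /andP[] : m0 <= ell lo <= m1; [apply: mP; rewrite lexx|lra].
have Ksub : [set` `[lo, hi]] `<=` [set x | 0 < x /\ (x%:E < hprof ell)%E].
  move=> x /=; rewrite in_itv /= => /andP[lx xh]; split; first lra.
  by apply: le_lt_trans hih; rewrite lee_fin.
have U := unif _ (@segment_compact _ lo hi) Ksub.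
have near_unif : \forall n \near \oo, forall x, lo <= x <= hi ->
    `|ell x - (cm_q (C n) (Num.truncn (n%:R * x)))%:R / n%:R| < m0 / 2.
  have e0 : 0 < m0 / 2 by lra.
  have V : nbhs (ell : {uniform` [set` `[lo, hi]] -> R})
      [set g | forall x, [set` `[lo, hi]] x -> ball (ell x) (m0 / 2) (g x)].
    apply/uniform_nbhs; exists [set xy : R * R | ball xy.1 (m0 / 2) xy.2]; split=> //.
    exact: (entourage_ball _ (PosNum e0)).
  have UV : \forall n \near \oo, forall x, [set` `[lo, hi]] x ->
    ball (ell x) (m0 / 2) ((cm_q (C n) (Num.truncn (n%:R * x)))%:R / n%:R) := U _ V.
  apply: filterS UV => n nP x xP.
  by apply: nP; rewrite /= in_itv.
near=> n => s /andP[ls sh].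
have n0 : (0 < n)%N by near: n; exact: nbhs_infty_gt.
have n0' : 0 < n%:R :> R by rewrite ltr0n.
have xP : lo <= s%:R / n%:R <= hi by rewrite ler_pdivlMr// ls ler_pdivrMr.
have /andP[e0 e1] := mP _ xP.
have hn : forall x, lo <= x <= hi ->
  `|ell x - (cm_q (C n) (Num.truncn (n%:R * x)))%:R / n%:R| < m0 / 2 by near: n.
have := hn _ xP; rewrite truncn_mul_div//.
rewrite ltr_norml => /andP[d0 d1]; rewrite -ler_pdivlMr// -[X in _ && X]ler_pdivrMr//.
by apply/andP; split; lra.
Unshelve. all: by end_near. Qed.

Lemma near_bulk (lo hi h : R) : H1 C ell sigma -> hprof ell = h%:E ->
  0 < lo -> hi < h ->
  exists delta : R, 0 < delta /\ \forall n \near \oo, forall s : nat,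
    lo * n%:R <= s%:R <= hi * n%:R -> bulk C n delta s.
Proof.
move=> [_ [[hcv _ _] _ _]] hE lo0 hih.
(* The second argument works because [h(q_n) / n] eventually exceeds the midpoint of [hi] and
   [h]. *)
pose delta := Num.min lo ((h - hi) / 2).
have delta0 : 0 < delta by rewrite lt_min lo0; lra.
exists delta; split => //.
have near_h : \forall n \near \oo,
    (((h + hi) / 2)%:E < hmodel (C n) * (n%:R^-1)%:E)%E.
  have V : nbhs h%:E [set y : \bar R | (((h + hi) / 2)%:E < y)%E].
    apply/nbhs_EFin; have : (h + hi) / 2 < h by lra.
    by move/lt_nbhsr; apply: filterS => y; rewrite /= lte_fin.
  by rewrite hE in hcv; exact: hcv _ V.
near=> n => s /andP[ls sh].
have n0 : (0 < n)%N by near: n; exact: nbhs_infty_gt.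
have n0' : 0 < n%:R :> R by rewrite ltr0n.
have hn : (((h + hi) / 2)%:E < hmodel (C n) * (n%:R^-1)%:E)%E by near: n.
have dlo : delta <= lo by rewrite ge_min lexx.
have dhi : delta <= (h - hi) / 2 by rewrite ge_min lexx orbT.
split; first by rewrite lee_fin (le_trans _ ls)// ler_wpM2r.
move: hn; case: (hmodel (C n)) => [x| |].
- rewrite -EFinM lte_fin ltr_pdivlMr// => hx; rewrite lee_fin.
  have : delta * n%:R <= (h - hi) / 2 * n%:R by rewrite ler_wpM2r.
  lra.
- by rewrite leey.
- by rewrite gt0_mulNye ?lte_fin ?invr_gt0.
Unshelve. all: by end_near. Qed.

End scaling.

Unset Implicit Arguments.

Theorem theorem3p13 (R : realType) (C : nat -> cannings_model R)
    (ell sigma : R -> R) (hl hu : nat -> nat) (Hl Hu : R) :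
  H1 C ell sigma -> H2a C ->
  (forall n : nat, (0 < n)%N ->
     [/\ (0 < hl n)%N, (hl n < hu n)%N &
         ((hu n)%:R%:E < hmodel (C n))%E]) ->
  (hl n)%:R / n%:R @[n --> \oo] --> Hl ->
  (hu n)%:R / n%:R @[n --> \oo] --> Hu ->
  0 < Hl -> Hl < Hu -> (Hu%:E < hprof ell)%E ->
  (fun M : R => limn_esup (fun n : nat =>
     cm_P (C n) [set w | M < (nb_with_descendant (hl n) (hu n) w)%:R]))
    @ pinfty_nbhs R --> 0%E.
Proof.
move=> H1P H2P hP hlP huP Hl0 HlHu Huh.
(* Given an eventual bound [K] on the mean, Markov's inequality bounds the tail by [K / M]. *)
suff [K [K0 KP]] : exists K : R, 0 < K /\ \forall n \near \oo,
    mean_ancestors (C n) (hu n - hl n) (hl n) <= K.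
  pose u (M : R) := limn_esup (fun n : nat =>
     cm_P (C n) [set w | M < (nb_with_descendant (hl n) (hu n) w)%:R]).
  apply: (@squeeze_cvge _ _ _ _ (cst 0%E) _ (fun M => (K / M)%:E)).
  - near=> M; apply/andP; split.
      apply: limf_esup_ge0 => [|n]; last exact: measure_ge0.
      by move=> [N _ /(_ N)]; apply => /=.
    have M0 : 0 < M by near: M; exact: nbhs_pinfty_gt.
    apply: limn_esup_le_near; near=> n.
    have n0 : (0 < n)%N by near: n; exact: nbhs_infty_gt.
    have [hl0 hlhu _] := hP _ n0.
    rewrite -[hu n](subnKC (ltnW hlhu)).
    under eq_set => w do rewrite nb_with_descendantE//.
    apply: le_trans (pr_ancestors_gt _ _ hl0 M0) _.
    rewrite lee_fin ler_pM2r ?invr_gt0//.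
    by near: n.
  - exact: cvg_cst.
  - apply/fine_cvgP; split; first exact: nearW.
    apply/cvgrPdist_lt => e e0; near=> M.
    have M0 : 0 < M by near: M; exact: nbhs_pinfty_gt.
    rewrite sub0r normrN ger0_norm ?divr_ge0// ?ltW//=.
    rewrite ltr_pdivrMr// mulrC -ltr_pdivrMr//.
    by near: M; apply: nbhs_pinfty_gt; rewrite num_real.
have [h hE] : exists h, hprof ell = h%:E.
  case: H1P => [[_ _ _ hy] _]; move: hy Huh.
  by case: (hprof ell) => // h _ _; exists h.
move: (Huh); rewrite hE lte_fin => Huh'.
(* All heights between [hl n] and [hu n], divided by [n], eventually lie in this compact part of
   [(0, h)]. *)
pose lo := Hl / 2; pose hi := (Hu + h) / 2.
have lo0 : 0 < lo by rewrite /lo; lra.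
have lohi : lo <= hi by rewrite /lo /hi; lra.
have hih : hi < h by rewrite /hi; lra.
have hih' : (hi%:E < hprof ell)%E by rewrite hE lte_fin.
have [q1 [q2 [q10 q2P qP]]] := near_profile_bounds H1P lo0 lohi hih'.
have [delta [delta0 bulkP]] := near_bulk H1P hE lo0 hih.
have [eps eps0 /limn_einf_gt0_near[c c0 cP]] := H2P delta delta0.
have cP' : \forall n \near \oo, forall s, bulk C n delta s ->
    (c%:E <= expectation (cm_P (C n)) (fun w => (nu1 s w ^_ 2)%:R *
    (if (nu1 s w)%:R <= n%:R / (ln n%:R) `^ (1 + eps) then 1 else 0))%R)%E.
  apply: filterS cP => n cn s bs; apply: le_trans cn _.
  by apply: ereal_inf_lbound; exists s.
pose D := Hu - Hl; have D0 : 0 < D by rewrite /D; lra.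
pose kappa1 := c * q1 / (4 * q2 ^+ 2).
have kappa10 : 0 < kappa1.
  by rewrite /kappa1 divr_gt0 ?mulr_gt0 ?exprn_gt0//; lra.
have kD : 0 < kappa1 * (D / 8) by rewrite mulr_gt0// divr_gt0.
exists (1 + (kappa1 * (D / 8))^-1); split; first by rewrite addr_gt0// invr_gt0.
near=> n.
have n0 : (0 < n)%N by near: n; exact: nbhs_infty_gt.
have n0' : 0 < n%:R :> R by rewrite ltr0n.
have [hl0 hlhu _] := hP _ n0.
have cn : forall s, bulk C n delta s -> (c%:E <= expectation (cm_P (C n)) (fun w =>
    (nu1 s w ^_ 2)%:R *
    (if (nu1 s w)%:R <= n%:R / (ln n%:R) `^ (1 + eps) then 1 else 0))%R)%E.
  by near: n; exact: cP'.
have qn : forall s : nat, lo * n%:R <= s%:R <= hi * n%:R ->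
  q1 * n%:R <= (cm_q (C n) s)%:R <= q2 * n%:R by near: n.
have bn : forall s : nat, lo * n%:R <= s%:R <= hi * n%:R -> bulk C n delta s.
  by near: n.
have ln1 : 1 <= ln (n%:R : R) by near: n; exact: near_ln_ge.
(* Here [eps > 0] is essential: [ln n] to the power [eps] must exceed constants. [lnA] makes the
   contraction exponent at least [ln n], and [lnB] gives [q2 <= L / 2]. *)
have lnA : 2 / (kappa1 * (D / 8) * q1) <= (ln (n%:R : R)) `^ eps.
  by near: n; exact: near_ln_powR_ge.
have lnB : q2 * 2 / q1 <= (ln (n%:R : R)) `^ eps.
  by near: n; exact: near_ln_powR_ge.
have dl : `|Hl - (hl n)%:R / n%:R| < Num.min lo (D / 8).
  by near: n; move/cvgrPdist_lt : hlP; apply; rewrite lt_min lo0; lra.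
have du : `|Hu - (hu n)%:R / n%:R| < Num.min (hi - Hu) (D / 8).
  by near: n; move/cvgrPdist_lt : huP; apply; rewrite lt_min /hi; apply/andP; split; lra.
move: dl du; rewrite !lt_min !ltr_norml => /andP[/andP[_ dl1] /andP[dl2 dl3]].
move=> /andP[/andP[du1 _] /andP[du2 du3]].
have hl_lo : lo * n%:R <= (hl n)%:R by rewrite -ler_pdivlMr//; rewrite /lo in dl1 *; lra.
have hu_hi : (hu n)%:R <= hi * n%:R by rewrite -ler_pdivrMr//; lra.
have gap : 3 / 4 * D * n%:R <= (hu n)%:R - (hl n)%:R.
  by rewrite -ler_pdivlMr// mulrBl; rewrite /D in dl2 du3 *; lra.
(* This absorbs the rounding in [N], leaving [N] at least [D / 8 * n] and positive. *)
have nD : 8 <= D * n%:R.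
  by rewrite mulrC -ler_pdivrMr//; near: n; exact: nbhs_infty_ger.
pose N := (hu n - hl n)./2.
have NP : D / 8 * n%:R <= N%:R.
  have : (hu n)%:R - (hl n)%:R <= N%:R * 2 + 1 :> R.
    rewrite -natrB 1?ltnW// -natrM natr1 ler_nat /N muln2.
    by rewrite -[leqLHS]odd_double_half -addn1 addnC leq_add2l; case: odd.
  by lra.
have N0 : (0 < N)%N by rewrite -(ltr0n R); lra.
have srange s : (hl n <= s <= hu n)%N -> lo * n%:R <= s%:R <= hi * n%:R.
  move=> /andP[s1 s2]; apply/andP; split.
    by apply: le_trans hl_lo _; rewrite ler_nat.
  by apply: le_trans hu_hi; rewrite ler_nat.
(* [L] is chosen so that [L] times the truncation level of (H2a) is exactly [q1 * n]. *)
pose ln' := ln (n%:R : R); pose L := q1 * ln' `^ (1 + eps).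
have ln0 : 0 < ln' by rewrite (lt_le_trans _ ln1).
have lnX : ln' `^ (1 + eps) = ln' * ln' `^ eps.
  by rewrite powRD ?powRr1 ?ltW//; rewrite (gt_eqF ln0) implybT.
have L0 : 0 < L by rewrite mulr_gt0// powR_gt0.
have kE : c * (q1 * n%:R) / (4 * (q2 * n%:R) ^+ 2) = kappa1 / n%:R.
  by rewrite /kappa1; field; rewrite !gt_eqF//; lra.
(* The coefficient is of order [1 / n] and the number of generations of order [n], so their product
   stays bounded below. *)
have kN : kappa1 * (D / 8) <= kappa1 / n%:R * N%:R.
  rewrite -[leRHS]mulrA [_^-1 * _]mulrC ler_wpM2l ?(ltW kappa10)// ler_pdivlMr//.
apply: le_trans
  (@mean_ancestors_le R (C n) (hl n) (hu n) N L (n%:R / ln' `^ (1 + eps))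
  c (q1 * n%:R) (q2 * n%:R) hl0 N0 _ c0 _ _ _ (ltW L0) _ _) _.
- by rewrite -[leqRHS]odd_double_half leq_addl.
- by rewrite mulrC -ltr_pdivrMr//; near: n; exact: nbhs_infty_gtr.
- by move=> s /srange; exact: qn.
- by move=> s /andP[s1 s2]; apply: cn; apply: bn; apply: srange; rewrite s1 ltnW.
- by rewrite /L mulrACA mulfV ?mulr1// gt_eqF// powR_gt0.
(* The initial size [q2 * n] is contracted by at least a factor [n], and the remaining [q2] is below
   [L / 2]. *)
- rewrite kE; apply: (@le_trans _ _ (q2 * n%:R * expR (- ln'))).
    rewrite ler_wpM2l ?mulr_ge0 ?(ltW n0')//; first lra.
    rewrite ler_expR lerN2; apply: (@le_trans _ _ (kappa1 * (D / 8) * L / 2)).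
      rewrite /L lnX.
      have : 2 <= kappa1 * (D / 8) * q1 * ln' `^ eps.
        by rewrite mulrC -ler_pdivrMr// mulr_gt0.
      move=> /(ler_wpM2r (ltW ln0)); lra.
    rewrite -![_ * L / 2]mulrA [leRHS]mulrAC ler_wpM2r// divr_ge0// ltW//.
  rewrite expRN lnK ?posrE// mulfK ?gt_eqF// ler_pdivlMr// /L lnX.
  move: lnB; rewrite ler_pdivrMr// => h1; apply: (le_trans h1).
  rewrite mulrC ler_wpM2l ?(ltW q10)//.
  by rewrite ler_peMl// powR_ge0.
by rewrite kE lerD2l lef_pV2// posrE ?(lt_le_trans kD kN).
Unshelve. all: by end_near. Qed.
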